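(* Let $k\ge 3$ and $1\le\ell<k/2$ be integers and let $\eta>0$. There exists $\gamma_0>0$ such that for every $0<\gamma\le\gamma_0$ there exists $\theta_0>0$ such that for every $0<\theta\le\theta_0$ there exists $n_0$ such that the following holds for every $n\ge n_0$. Let $H$ be a $k$-graph on $n$ vertices satisfying at least one of the following: (i) $\ell\ge 2$ and $\delta_\ell(H)\ge\left(\max\left\{1/3,(1/2)^{\frac{k-\ell}{\ell}}\right\}+\eta\right)\binom{n}{k-\ell}$; (ii) $\delta_{\ell+1}(H)\ge(1/3+\eta)\binom{n}{k-\ell-1}$. Then there exists an $\ell$-path $P$ in $H$ with $|V(P)|\le\gamma n$ such that $P$ can absorb any set $X\subseteq V(H)\setminus V(P)$ with $|X|\le\theta n$ and $(k-\ell)\mid|X|$; that is, for every such $X$ there exists an $\ell$-path $Q$ in $H$ with the same ordered ends as $P$ and with $V(Q)=V(P)\cup X$.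
   Context: A $k$-graph $H=(V,E)$ ($k\ge 2$) has a vertex set $V=V(H)$ and an edge set $E\subseteq\binom{V}{k}$. For $S\in\binom{V}{d}$, $\deg_H(S)$ is the number of $T\in\binom{V}{k-d}$ with $S\cup T\in E$, and the minimum $d$-degree $\delta_d(H)$ is the minimum of $\deg_H(S)$ over all $S\in\binom{V}{d}$. For $1\le\ell<k$, a $k$-graph is an $\ell$-path if there is a (non-cyclic) linear ordering of its vertices such that every edge consists of $k$ consecutive vertices and any two consecutive edges (in the natural order of the edges) share exactly $\ell$ vertices. The first $\ell$ vertices and the last $\ell$ vertices, taken in this ordering, are the (ordered) ends of the path. *)

(* Defs.v *)
From HB Require Import structures.
From mathcomp Require Import all_boot.

Set Implicit Arguments.
Unset Strict Implicit.
Unset Printing Implicit Defensive.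

Record kgraph (k : nat) (V : finType) := KGraph {
  edges : {set {set V}};
  edges_uniform : forall e, e \in edges -> #|e| = k
}.

Definition deg (k : nat) (V : finType) (H : kgraph k V) (d : nat)
    (S : {set V}) : nat :=
  #|[set T : {set V} | (#|T| == k - d) && (S :|: T \in edges H)]|.

(* The default value 'C(#|V|, k - d) bounds every degree from above, so it
   matters only when V has no d-subset. *)
Definition mindeg (k : nat) (V : finType) (H : kgraph k V) (d : nat) : nat :=
  \big[minn/'C(#|V|, k - d)]_(S : {set V} | #|S| == d) deg H d S.

Definition window (k : nat) (V : finType) (s : seq V) (i : nat) : {set V} :=
  [set x in take k (drop i s)].

(* s is a vertex ordering witnessing that the k-graph with vertex set
   [set x in s] and edge set F is an l-path. The list I holds the starting
   positions of the edges in their natural order. Isolated vertices are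
   excluded by the condition on cover F, and edgeless paths by I != [::]. *)
Definition lpath_ordering (k l : nat) (V : finType) (F : {set {set V}})
    (s : seq V) : Prop :=
  [/\ uniq s, cover F = [set x in s] &
      exists I : seq nat,
        [/\ I != [::] /\ sorted ltn I,
            forall i, i \in I -> i + k <= size s,
            F = [set:: [seq window k s i | i <- I]] &
            forall j, j.+1 < size I ->
              #|window k s (nth 0 I j) :&: window k s (nth 0 I j.+1)| = l]].

(* An l-path in H, given by its ordering. *)
Definition lpath_in (k l : nat) (V : finType) (H : kgraph k V)
    (s : seq V) : Prop :=
  exists2 F : {set {set V}}, F \subset edges H & lpath_ordering k l F s.

Definition first_end (l : nat) (V : finType) (s : seq V) : seq V := take l s.

Definition last_end (l : nat) (V : finType) (s : seq V) : seq V :=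
  drop (size s - l) s.

Definition absorbs (k l : nat) (V : finType) (H : kgraph k V)
    (P : seq V) (X : {set V}) : Prop :=
  exists Q : seq V,
    [/\ lpath_in l H Q,
        first_end l Q = first_end l P,
        last_end l Q = last_end l P &
        [set x in Q] = [set x in P] :|: X].

(* Main.v *)
(* All counting is done with averages over tuples of vertices, so that every
   bound is a positive constant independent of the number n of vertices.

   Connecting. Call two l-tuples near if they are the ends of a positive
   proportion of edges. Under (i), the Kruskal-Katona theorem (in
   Loomis-Whitney form) shows that every l-tuple is near more than half of all
   tuples, so any two have many common neighbours. Under (ii), every tuple is
   near more than a third of all tuples, and so is almost every pair of tuples
   differing in one place, simultaneously; hence the tuples at distance two
   from L and those at distance two from L' form sets that cover everything and
   can only be separated at their intersection, and by an isoperimetric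
   (Efron-Stein) argument that intersection is large. In both cases any two
   disjoint l-tuples are joined by many l-paths with q edges for each q >= 4.

   Exchanging. If z, w lie in a common edge, with z in the overlap of that edge
   with the next one, then z and w may swap places without changing the edge;
   the next edge then loses z and gains w. With T + yz, T + zw, T + wx edges
   this frees y and uses x instead. For almost all pairs x, y there are many
   such T, z, w, because all but few edges of a dense graph (the link of T) lie
   in many 4-cycles.

   Absorbing. Given a set X of k - l vertices, take an l-path through X and an
   l-path with one edge less and the same ends, and exchange the remaining
   vertices of the first for those of the second. A greedy choice driven by an
   exponential potential yields a short path with linearly many disjoint
   absorbers for every X. *)
Require Import Defs.
From mathcomp Require Import fingroup perm.
From mathcomp Require Import all_boot all_order all_algebra.
From mathcomp Require Import boolp reals exp.
From mathcomp Require Import ring lra zify.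
Import Order.TTheory GRing.Theory Num.Theory.

Set Implicit Arguments.
Unset Strict Implicit.
Unset Printing Implicit Defensive.

Local Open Scope ring_scope.

(** * Averages over tuples of vertices *)

Section Average.

Variables (R : realType) (V : finType).
Hypothesis V_gt0 : (0 < #|V|)%N.

(** The average runs over all [m]-tuples, repetitions included, one coordinate at a time, so that
    splitting a tuple and exchanging coordinates are plain inductions. Tuples with a repetition have
    density O(1/n) and are discarded only where needed. *)
Fixpoint avg_rec (m : nat) (f : seq V -> R) : R :=
  if m is m'.+1 then (\sum_(v : V) avg_rec m' (fun s => f (v :: s))) / #|V|%:R
  else f [::].

Fact avg_key : unit. Proof. by []. Qed.

(* Locked, as unification would otherwise compute averages. *)
Definition avg := locked_with avg_key avg_rec.

Lemma avg0 f : avg 0 f = f [::].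
Proof. by rewrite /avg unlock. Qed.

Lemma avgS m f :
  avg m.+1 f = (\sum_(v : V) avg m (fun s => f (v :: s))) / #|V|%:R.
Proof. by rewrite /avg unlock. Qed.

Let nV_gt0 : 0 < #|V|%:R :> R. Proof. by rewrite ltr0n. Qed.
Let nV_neq0 : #|V|%:R != 0 :> R. Proof. by rewrite gt_eqF. Qed.

Lemma eq_avg m f g : (forall s, size s = m -> f s = g s) -> avg m f = avg m g.
Proof.
elim: m f g => [|m IH] f g fg; first by rewrite !avg0 fg.
rewrite !avgS.
by congr (_ / _); apply: eq_bigr => v _; apply: IH => s sz; rewrite fg //= sz.
Qed.

Lemma ler_avg m f g : (forall s, size s = m -> f s <= g s) -> avg m f <= avg m g.
Proof.
elim: m f g => [|m IH] f g fg; first by rewrite !avg0 fg.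
rewrite !avgS.
rewrite ler_pM2r ?invr_gt0 //; apply: ler_sum => v _.
by apply: IH => s sz; rewrite fg //= sz.
Qed.

Lemma avg_const m c : avg m (fun=> c) = c.
Proof.
elim: m => [|m IH]; rewrite ?avg0 // avgS (eq_bigr (fun=> c)) // sumr_const.
by rewrite -[X in X / _]mulr_natr; exact: mulfK.
Qed.

Lemma avg_ge0 m f : (forall s, size s = m -> 0 <= f s) -> 0 <= avg m f.
Proof. by move=> f0; rewrite -(avg_const m 0); apply: ler_avg. Qed.

Lemma avg_le1 m f : (forall s, size s = m -> f s <= 1) -> avg m f <= 1.
Proof. by move=> f1; rewrite -(avg_const m 1); apply: ler_avg. Qed.

Lemma avgD m f g : avg m (fun s => f s + g s) = avg m f + avg m g.
Proof.
elim: m f g => [|m IH] f g; rewrite ?avg0 // !avgS.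
by rewrite -mulrDl -big_split /=; congr (_ / _); apply: eq_bigr => v _; rewrite IH.
Qed.

Lemma avgZ m c f : avg m (fun s => c * f s) = c * avg m f.
Proof.
elim: m f => [|m IH] f; rewrite ?avg0 // !avgS.
rewrite (eq_bigr (fun v => c * avg m (fun s => f (v :: s)))) => [|v _]; last exact: IH.
by rewrite -mulr_sumr mulrA.
Qed.

Lemma avgZr m c f : avg m (fun s => f s * c) = avg m f * c.
Proof. by rewrite mulrC -avgZ; apply: eq_avg => s _; rewrite mulrC. Qed.

Lemma avgB m f g : avg m (fun s => f s - g s) = avg m f - avg m g.
Proof.
rewrite -[- avg m g]mulN1r -avgZ -avgD; apply: eq_avg => s _.
by rewrite mulN1r.
Qed.

Lemma avg_compl m f : 1 - avg m f = avg m (fun s => 1 - f s).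
Proof. by rewrite avgB avg_const. Qed.

Lemma avg_sum (I : Type) (r : seq I) (P : pred I) m (F : I -> seq V -> R) :
  avg m (fun s => \sum_(i <- r | P i) F i s) = \sum_(i <- r | P i) avg m (F i).
Proof.
elim: r => [|i r IH].
  by rewrite (@eq_avg _ _ (fun=> 0)) ?avg_const ?big_nil // => s _; rewrite big_nil.
rewrite big_cons; case: ifP => Pi.
  by rewrite -IH -avgD; apply: eq_avg => s _; rewrite big_cons Pi.
by rewrite -IH; apply: eq_avg => s _; rewrite big_cons Pi.
Qed.

Lemma avg_cat m1 m2 f :
  avg (m1 + m2) f = avg m1 (fun s => avg m2 (fun t => f (s ++ t))).
Proof.
elim: m1 f => [|m IH] f; rewrite ?avg0 // addSn !avgS.
by congr (_ / _); apply: eq_bigr => v _; rewrite IH.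
Qed.

Lemma avg_swap m1 m2 (f : seq V -> seq V -> R) :
  avg m1 (fun s => avg m2 (f s)) = avg m2 (fun t => avg m1 (fun s => f s t)).
Proof.
elim: m1 f => [|m IH] f; first by rewrite avg0; apply: eq_avg => t _; rewrite avg0.
rewrite avgS; under [RHS]eq_avg => t _ do rewrite avgS.
rewrite avgZr avg_sum; congr (_ / _).
by apply: eq_bigr => v _; apply: IH.
Qed.

Lemma avg1E f : avg 1 f = (\sum_(v : V) f [:: v]) / #|V|%:R.
Proof. by rewrite avgS; under eq_bigr do rewrite avg0. Qed.

Lemma avg_cons m f : avg m.+1 f = avg 1 (fun s => avg m (fun t => f (s ++ t))).
Proof. exact: (avg_cat 1 m). Qed.

Lemma avg_exists m f c : c <= avg m f -> exists2 s, size s = m & c <= f s.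
Proof.
elim: m f => [|m IH] f; first by rewrite avg0; exists [::].
rewrite avgS.
rewrite ler_pdivlMr // => le_c.
have [[v le_v] | no_v] := pselect (exists v, c <= avg m (fun s => f (v :: s))).
  by have [s sz le_s] := IH _ le_v; exists (v :: s); rewrite //= sz.
suff : \sum_(v : V) avg m (fun s => f (v :: s)) < c * #|V|%:R by rewrite ltNge le_c.
have /card_gt0P[v0 _] := V_gt0.
rewrite mulr_natr -sumr_const; apply: ltr_sum => [|v _].
  by apply/hasP; exists v0; rewrite ?mem_index_enum.
by rewrite ltNge; apply/negP => h; apply: no_v; exists v.
Qed.

Lemma avg_CS m f : avg m f ^+ 2 <= avg m (fun s => f s ^+ 2).
Proof.
rewrite -subr_ge0; set a := avg m f.
have -> : avg m (fun s => f s ^+ 2) - a ^+ 2 = avg m (fun s => (f s - a) ^+ 2).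
  transitivity (avg m (fun s => f s ^+ 2 - (a *+ 2) * f s + a ^+ 2)).
    by rewrite avgD avgB avgZ avg_const -/a; ring.
  by apply: eq_avg => s _; ring.
by apply: avg_ge0 => s _; apply: sqr_ge0.
Qed.

Lemma avg_markov m (f : seq V -> R) (c : R) : (forall s, size s = m -> 0 <= f s) ->
  c * avg m (fun s => (c <= f s)%R%:R) <= avg m f.
Proof.
move=> f0; rewrite -avgZ; apply: ler_avg => s sz.
by have [le_c|_] := boolP (c <= f s); rewrite ?mulr1 // mulr0 f0.
Qed.

(** The product rule by which composite structures are counted: the pieces are chosen one after the
    other, and the condition [Q] on the next piece may depend on the previous one. *)
Lemma avg_bind m1 m2 a b (P : pred (seq V)) (Q : seq V -> pred (seq V))
    (S : pred (seq V)) : 0 <= b ->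
  a <= avg m1 (fun s => (P s)%:R) ->
  (forall s, size s = m1 -> P s -> b <= avg m2 (fun t => (Q s t)%:R)) ->
  (forall s t, size s = m1 -> size t = m2 -> P s -> Q s t -> S (s ++ t)) ->
  a * b <= avg (m1 + m2) (fun s => (S s)%:R).
Proof.
move=> b0 le_a le_b PQS; apply: (le_trans (ler_wpM2r b0 le_a)).
rewrite -avgZr avg_cat; apply: ler_avg => s szs.
case Ps: (P s); last by rewrite mul0r; apply: avg_ge0 => t _; rewrite ler0n.
rewrite mul1r; apply: (le_trans (le_b _ szs Ps)); apply: ler_avg => t szt.
rewrite ler_nat; case Qst: (Q s t) => //.
by rewrite (PQS s t).
Qed.

Lemma avg_tuple m f :
  avg m f = (\sum_(t : m.-tuple V) f t) / #|V|%:R ^+ m.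
Proof.
elim: m f => [|m IH] f; rewrite ?avg0 ?avgS.
  rewrite expr0 divr1 (big_pred1 [tuple]) // => t.
  by apply/esym/eqP; rewrite tuple0.
rewrite exprS invfM mulrA mulrAC; congr (_ / _).
under eq_bigr do rewrite IH.
rewrite -mulr_suml; congr (_ / _).
rewrite pair_big /= (reindex (fun p : V * m.-tuple V => [tuple of p.1 :: p.2])) //=.
exists (fun t : m.+1.-tuple V => (thead t, [tuple of behead t])) => [[v t] _ | t _] /=.
  by rewrite theadE; congr (_, _); apply: val_inj.
by rewrite -tuple_eta.
Qed.

Lemma avg_mem_le (x : V) m :
  avg m (fun s => (x \in s)%:R) <= m%:R / #|V|%:R.
Proof.
elim: m => [|m IH]; first by rewrite avg0 mul0r.
apply: (@le_trans _ _ (avg 1 (fun s => (x \in s)%:R) + avg m (fun s => (x \in s)%:R))).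
  rewrite avg_cons.
  apply: (@le_trans _ _ (avg 1 (fun s => avg m (fun t => (x \in s)%:R + (x \in t)%:R)))).
    apply: ler_avg => s _; apply: ler_avg => t _.
    by rewrite mem_cat -natrD ler_nat; do 2!case: (x \in _).
  by under eq_avg => s _ do rewrite avgD avg_const; rewrite avgD avg_const.
rewrite -natr1 mulrDl addrC lerD //.
rewrite avg1E ler_pM2r ?invr_gt0 // (eq_bigr (fun v => (v == x)%:R)) => [|v _].
  by rewrite (bigD1 x) //= eqxx big1 ?addr0 // => v /negbTE->.
by rewrite inE eq_sym.
Qed.

Lemma avg_meets_le (A : seq V) m :
  avg m (fun s => (has (mem A) s)%:R) <= m%:R * (size A)%:R / #|V|%:R.
Proof.
apply: (@le_trans _ _ (avg m (fun s => \sum_(x <- A) (x \in s)%:R))).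
  apply: ler_avg => s _; case: hasP => [[x xs /= xA]|_]; last by rewrite sumr_ge0.
  by rewrite -natr_sum ler1n lt0n sum_nat_seq_neq0; apply/hasP; exists x; rewrite ?xs.
rewrite avg_sum mulrAC; apply: (@le_trans _ _ (\sum_(x <- A) (m%:R / #|V|%:R))).
  by apply: ler_sum => x _; apply: avg_mem_le.
by rewrite big_const_seq count_predT iter_addr_0 -[leLHS]mulr_natr.
Qed.

Lemma avg_nuniq_le m :
  avg m (fun s => (~~ uniq s)%:R) <= (m * m)%:R / #|V|%:R.
Proof.
elim: m => [|m IH]; first by rewrite avg0 mul0r.
rewrite avg_cons.
apply: (@le_trans _ _ (avg 1 (fun s => avg m (fun t => (has (mem s) t)%:R + (~~ uniq t)%:R)))).
  apply: ler_avg => s szs; apply: ler_avg => t _.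
  case: s szs => [//|v [|//]] _ /=; rewrite negb_and negbK -natrD ler_nat.
  case: (boolP (v \in t)) => [vt|_] /=; last by rewrite leq_addl.
  by rewrite (_ : has _ _) //; apply/hasP; exists v; rewrite //= inE.
under eq_avg => s _ do rewrite avgD.
rewrite avgD avg_const; apply: (@le_trans _ _ (m%:R / #|V|%:R + (m * m)%:R / #|V|%:R)).
  apply: lerD => //; rewrite -[leRHS](avg_const 1); apply: ler_avg => s szs.
  by have := avg_meets_le s m; rewrite szs mulr1.
by rewrite -mulrDl ler_pM2r ?invr_gt0 // -natrD ler_nat; lia.
Qed.

End Average.

(** * Walks *)

Section Paths.

Variables (k l : nat) (V : finType) (H : kgraph k V).

Definition spans_edge (s : seq V) : bool := [set x in s] \in edges H.

Lemma eq_spans_edge (s t : seq V) : s =i t -> spans_edge s = spans_edge t.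
Proof.
move=> st; rewrite /spans_edge (_ : [set x in s] = [set x in t]) //.
by apply/setP => x; rewrite !inE st.
Qed.

Lemma perm_spans_edge s t : perm_eq s t -> spans_edge s = spans_edge t.
Proof. by move=> /perm_mem; apply: eq_spans_edge. Qed.

Lemma spans_edge_uniq s : size s = k -> spans_edge s -> uniq s.
Proof.
move=> szs /edges_uniform e; apply/card_uniqP; rewrite szs -{}e.
by apply: eq_card => x; rewrite inE.
Qed.

(* An l-path with q edges, listed vertex by vertex, except that vertices may
   repeat. *)
Definition walk (q : nat) (p : seq V) : bool :=
  (size p == q * (k - l) + l)%N &&
  all (fun i => spans_edge (take k (drop (i * (k - l)) p))) (iota 0 q).

Lemma size_walk q p : walk q p -> size p = (q * (k - l) + l)%N.
Proof. by case/andP => /eqP. Qed.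

Lemma walk0 p : walk 0 p = (size p == l).
Proof. by rewrite /walk andbT. Qed.

Hypothesis l2_lt_k : (2 * l < k)%N.

Lemma walk1 p : walk 1 p = (size p == k) && spans_edge p.
Proof.
rewrite /walk /= mul1n subnK; last lia.
by case: eqP => //= szp; rewrite mul0n drop0 -szp take_size andbT.
Qed.

Lemma walk_edge q p i : walk q p -> (i < q)%N ->
  spans_edge (take k (drop (i * (k - l)) p)).
Proof. by case/andP => _ /allP e iq; apply: e; rewrite mem_iota. Qed.

(** Since [a] has exactly [q1 * (k - l)] vertices, the edges of the second walk start at the right
    multiples of [k - l], and every required edge lies inside one of the two walks. *)
Lemma walk_cat q1 q2 a L b : size L = l ->
  walk q1 (a ++ L) -> walk q2 (L ++ b) -> walk (q1 + q2) (a ++ L ++ b).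
Proof.
move=> szL w1 w2; have := size_walk w1; have := size_walk w2.
rewrite !size_cat szL => szb sza.
have {}sza : size a = (q1 * (k - l))%N by lia.
apply/andP; split; first by rewrite !size_cat szL; apply/eqP; lia.
apply/allP => i; rewrite mem_iota add0n /= => iq.
have [iq1|q1i] := ltnP i q1.
  have := walk_edge w1 iq1; congr (is_true (spans_edge _)).
  rewrite catA [in RHS]drop_cat.
  have ik : (i * (k - l) + k <= size (a ++ L))%N.
    rewrite size_cat szL sza.
    have : (i.+1 * (k - l) <= q1 * (k - l))%N by rewrite leq_mul2r iq1 orbT.
    by rewrite mulSn; lia.
  rewrite ifT; last by lia.
  by rewrite takel_cat // size_drop; lia.
have i2 : (i - q1 < q2)%N by lia.
have := walk_edge w2 i2; congr (is_true (spans_edge (take k _))).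
by rewrite [in RHS]drop_cat sza ltn_mul2r [(i < q1)%N]ltnNge q1i andbF -mulnBl.
Qed.

Lemma walk_uniq_first q A s : size A = l -> walk q.+1 (A ++ s) -> uniq A.
Proof.
move=> szA w; have := walk_edge w (ltn0Sn q); rewrite mul0n drop0.
have := size_walk w; rewrite mulSn => szw.
move/spans_edge_uniq; rewrite size_takel; last by lia.
by rewrite take_cat szA ifF ?cat_uniq; [move/(_ erefl)/and3P => [] | lia].
Qed.

Lemma walk_uniq_last q s B : size B = l -> walk q.+1 (s ++ B) -> uniq B.
Proof.
move=> szB w; have := walk_edge w (ltnSn q).
have := size_walk w; rewrite mulSn => szw.
have szd : size (drop (q * (k - l)) (s ++ B)) = k by rewrite size_drop; lia.
rewrite take_oversize ?szd // => /(spans_edge_uniq szd).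
move: szw; rewrite size_cat szB => szs.
by rewrite drop_cat ifT ?cat_uniq; [case/and3P | lia].
Qed.

Lemma walk_lpath q p : (0 < q)%N -> uniq p -> walk q p -> lpath_in l H p.
Proof.
move=> q0 up w; have szp := size_walk w.
pose I := [seq i * (k - l)%N | i <- iota 0 q]%N.
have bound i : (i < q)%N -> (i * (k - l) + k <= size p)%N.
  move=> iq; rewrite szp.
  have : (i.+1 * (k - l) <= q * (k - l))%N by rewrite leq_mul2r iq orbT.
  by rewrite mulSn; lia.
exists [set:: [seq window k p i | i <- I]].
  apply/subsetP => e; rewrite inE => /mapP[j /mapP[i]].
  rewrite mem_iota /= => iq -> ->; exact: walk_edge w iq.
split=> //.
  apply/setP => x; rewrite inE; apply/bigcupP/idP => [[e]|xp].
    rewrite inE => /mapP[j _ ->]; rewrite inE => /mem_take; exact: mem_drop.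
  (* The minimum takes care of the last [l] vertices, which come after the start of the last
     possible edge and belong to that edge. *)
  pose i := minn (index x p %/ (k - l)) q.-1.
  have iq : (i < q)%N by rewrite /i; lia.
  exists (window k p (i * (k - l))).
    by rewrite inE; apply: map_f; apply: map_f; rewrite mem_iota.
  have ix : (index x p < size p)%N by rewrite index_mem.
  have ix1 : (i * (k - l) <= index x p)%N.
    apply: leq_trans (leq_trunc_div (index x p) (k - l)).
    by rewrite leq_mul2r /i geq_minl orbT.
  have ix2 : (index x p < i * (k - l) + k)%N.
    rewrite /i; case: (leqP (index x p %/ (k - l)) q.-1) => iq1.
      have := ltn_ceil (index x p) (_ : 0 < k - l)%N.
      by rewrite mulSn => /(_ ltac:(lia)); lia.
    by move: ix; rewrite szp -{1}(prednK q0) mulSn; lia.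
  rewrite inE -(nth_index x xp) -{1}(subnKC ix1) -nth_drop.
  have ixk : (index x p - i * (k - l) < k)%N by lia.
  rewrite -(nth_take _ ixk) mem_nth // size_takel // size_drop.
  by have := bound i iq; lia.
exists I; split=> //.
- split; first by rewrite /I; case: (q) q0.
  rewrite /I sorted_map; apply: sub_sorted (iota_ltn_sorted 0 q) => i j /= ij.
  by rewrite ltn_mul2r ij andbT; lia.
- by move=> j /mapP[i]; rewrite mem_iota /= => iq ->; apply: bound.
move=> j; rewrite size_map size_iota => jq.
rewrite !(nth_map 0%N) ?size_iota ?nth_iota ?add0n //; try lia.
(* Seen from the start [d] of the earlier edge, the [l] vertices [v] end this edge and begin the
   next one; distinctness of the vertices excludes any further common vertex. *)
have := bound _ jq; set d := drop (j * (k - l)) p => bnd.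
have ud : uniq d by rewrite drop_uniq.
have szd : (k - l + k <= size d)%N by rewrite size_drop; lia.
have dj : drop (j.+1 * (k - l)) p = drop (k - l) d by rewrite drop_drop mulSn.
pose v := take l (drop (k - l) d).
have szv : size v = l by rewrite size_takel // size_drop; lia.
rewrite -[RHS]szv -(card_uniqP _); last by rewrite take_uniq ?drop_uniq.
apply: eq_card => x; rewrite !inE dj -/d.
have tk : take k d = take (k - l) d ++ v.
  by rewrite /v -[in LHS](@subnK l k) ?takeD //; lia.
have tk' : take k (drop (k - l) d) = v ++ take (k - l) (drop k d).
  rewrite -{1}(@subnKC l k) ?takeD; last lia.
  by rewrite drop_drop subnKC //; lia.
rewrite tk tk' !mem_cat; case: (x \in v) => //=; first by rewrite orbT.
rewrite orbF; apply/negP => /andP[x1 x2]; move: ud.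
rewrite -(cat_take_drop k d) cat_uniq => /and3P[_ /hasPn dis _].
by have /negP := dis _ (mem_take x2); apply; rewrite /= tk mem_cat x1.
Qed.

End Paths.

(** * Degrees and densities of walks *)

Section Degrees.

Variables (R : realType) (k l : nat) (V : finType) (H : kgraph k V).
Hypothesis V_gt0 : (0 < #|V|)%N.

Let nV_gt0 : 0 < #|V|%:R :> R. Proof. by rewrite ltr0n. Qed.

(** The minimum [d]-degree, normalised by the number of all ordered tuples, repetitions included, in
    place of a binomial coefficient. *)
Definition min_avg_degree (d : nat) (c : R) : Prop :=
  forall S, uniq S -> size S = d ->
    c <= avg (k - d) (fun s => (spans_edge H (S ++ s))%:R).

(** Each set counted by the degree has [(k - d)!] orderings, and each of them completes [S] to an
    edge. *)
Lemma deg_le_avg d (S : seq V) : uniq S -> size S = d -> (d <= k)%N ->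
  (deg H d [set x in S] * (k - d)`!)%:R / #|V|%:R ^+ (k - d)
    <= avg (R := R) (k - d) (fun s => (spans_edge H (S ++ s))%:R).
Proof.
move=> uS szS dk; rewrite avg_tuple ler_pM2r ?invr_gt0 ?exprn_gt0 // -natr_sum ler_nat.
rewrite (partition_big (fun t : (k - d).-tuple V => [set x in t]) xpredT) //=.
rewrite /deg -sum_nat_const big_mkcond /=; apply: leq_sum => T _.
case: ifP => //; rewrite inE => /andP[/eqP szT ST].
have := card_uniq_tuples (k - d) (mem T); rewrite szT ffactnn => <-.
rewrite -sum1_card [in X in (_ <= X)%N]big_mkcond [X in (X <= _)%N]big_mkcond /=.
apply: leq_sum => t _; rewrite inE; case: ifP => // /andP[tT ut].
have tE : [set x in t] = T.
  apply/eqP; rewrite eqEcard szT; apply/andP; split.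
    by apply/subsetP => x; rewrite inE => /(allP tT).
  by rewrite (eq_card (B := mem t)) ?(card_uniqP ut) ?size_tuple // => x; rewrite inE.
rewrite tE eqxx (_ : spans_edge H (S ++ t)) //.
rewrite /spans_edge (_ : [set x in S ++ t] = [set x in S] :|: T) //.
by apply/setP => x; rewrite -tE !inE mem_cat.
Qed.

Lemma mindeg_le_deg d (S : {set V}) : #|S| = d -> (mindeg H d <= deg H d S)%N.
Proof.
move=> szS; rewrite /mindeg; have := mem_index_enum S.
elim: (index_enum _) => [//|T r IH]; rewrite inE big_cons => /orP[/eqP<-|/IH le_r].
  by rewrite szS eqxx geq_minl.
by case: ifP => // _; apply: leq_trans (geq_minr _ _) le_r.
Qed.

Lemma avg_uniq m :
  avg (R := R) (V := V) m (fun s => (uniq s)%:R)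
    = (#|V| ^_ m)%:R / #|V|%:R ^+ m.
Proof.
rewrite avg_tuple -natr_sum; congr (_%:R / _).
have <- := card_uniq_tuples m (mem V).
rewrite -sum1_card [RHS]big_mkcond /=; apply: eq_bigr => t _; rewrite inE.
by rewrite (_ : all _ _) /=; [case: (uniq t) | apply/allP].
Qed.

Lemma avg_uniq_ge m :
  1 - (m * m)%:R / #|V|%:R <= avg (R := R) (V := V) m (fun s => (uniq s)%:R).
Proof.
rewrite lerBlDr; apply: (le_trans _ (lerD (lexx _) (avg_nuniq_le R V_gt0 m))).
rewrite -avgD // -[leLHS](avg_const V_gt0 m).
by apply: ler_avg => // s _; rewrite -natrD ler1n; case: (uniq s).
Qed.

(** The binomial coefficient times [(k - d)!] counts the repetition-free tuples, which are all but a
    fraction (k-d)^2/n of the tuples. *)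
Lemma mindeg_min_avg_degree d (a : R) : (d <= k)%N -> 0 <= a ->
  a * 'C(#|V|, k - d)%:R <= (mindeg H d)%:R ->
  min_avg_degree d (a * (1 - ((k - d) * (k - d))%:R / #|V|%:R)).
Proof.
move=> dk a0 le_a S uS szS; apply: le_trans (deg_le_avg uS szS dk).
have le_d : a * 'C(#|V|, k - d)%:R <= (deg H d [set x in S])%:R.
  apply: (le_trans le_a); rewrite ler_nat mindeg_le_deg //.
  by rewrite (eq_card (B := mem S)) ?(card_uniqP uS) // => x; rewrite inE.
apply: (le_trans (ler_wpM2l a0 (avg_uniq_ge (k - d)))).
rewrite avg_uniq mulrA ler_pM2r ?invr_gt0 ?exprn_gt0 //.
by rewrite -bin_ffact !natrM mulrA ler_wpM2r.
Qed.

Lemma min_avg_degree_le d c c' : c' <= c ->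
  min_avg_degree d c -> min_avg_degree d c'.
Proof. by move=> cc' dc S uS szS; apply: (le_trans cc'); apply: dc. Qed.

(** A random further vertex avoids [S] with probability at least 1 - d/n; the degree of the enlarged
    tuple then counts the rest. *)
Lemma min_avg_degreeS d c : 0 <= c -> (d < k)%N ->
  min_avg_degree d.+1 c -> min_avg_degree d ((1 - d%:R / #|V|%:R) * c).
Proof.
move=> c0 dk mdc S uS szS.
rewrite (_ : k - d = 1 + (k - d.+1))%N; last lia.
apply: (avg_bind V_gt0 (P := fun s => ~~ has (mem S) s)
  (Q := fun s t => spans_edge H (S ++ s ++ t))) => //.
- have := avg_meets_le R V_gt0 S 1; rewrite mul1r szS => le_d.
  rewrite lerBlDr; apply: (le_trans _ (lerD (lexx _) le_d)).
  rewrite -avgD // -[leLHS](avg_const V_gt0 1).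
  by apply: ler_avg => // s _; rewrite -natrD ler1n; case: (has _ _).
- move=> s szs Ss; have := mdc (S ++ s); rewrite size_cat szs szS addn1.
  rewrite cat_uniq uS Ss (_ : uniq s); last by case: s szs {Ss} => [|x [|]].
  by move=> /(_ erefl erefl); under eq_avg => t _ do rewrite -catA.
Qed.

(** Each descent by one costs a factor 1 - d/n, which is at least 1/2 because [2 * k <= #|V|]. *)
Lemma min_avg_degree_down d e c : 0 <= c -> (e <= d <= k)%N ->
  (2 * k <= #|V|)%N ->
  min_avg_degree d c -> min_avg_degree e (c / 2 ^+ (d - e)).
Proof.
move=> c0 /andP[ed dk] nk; move: ed dk; elim: d => [|d IH] in c c0 *.
  by rewrite leqn0 => /eqP-> _; rewrite expr0 divr1.
rewrite leq_eqVlt => /orP[/eqP-> _|]; first by rewrite subnn expr0 divr1.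
rewrite ltnS => ed dk mdc; rewrite subSn // exprS invfM mulrA.
apply: IH ed _ _; [by rewrite divr_ge0 | lia |].
apply: min_avg_degree_le (min_avg_degreeS c0 dk mdc).
rewrite mulrC ler_wpM2r // lerBrDr addrC -lerBrDr ler_pdivrMr //.
rewrite (_ : 1 - 2^-1 = 2^-1); last by field.
rewrite mulrC ler_pdivlMr // -natrM ler_nat; lia.
Qed.

Hypothesis l2_lt_k : (2 * l < k)%N.

(** A walk with [q] edges has [q * (k - l) + l] vertices, hence [q * (k - l) - l] outside its two
    ends. *)
Definition walk_density (q : nat) (L L' : seq V) : R :=
  avg (q * (k - l) - l) (fun s => (walk l H q (L ++ s ++ L'))%:R).

Lemma walk_density_ge0 q L L' : 0 <= walk_density q L L'.
Proof. by apply: avg_ge0 => // s _; rewrite ler0n. Qed.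

Lemma walk_density_le1 q L L' : walk_density q L L' <= 1.
Proof. by apply: avg_le1 => // s _; rewrite lern1 leq_b1. Qed.

Lemma walk_density1 L L' : size L = l -> size L' = l ->
  walk_density 1 L L' = avg (k - 2 * l) (fun s => (spans_edge H (L ++ s ++ L'))%:R).
Proof.
move=> szL szL'; rewrite /walk_density (_ : 1 * (k - l) - l = k - 2 * l)%N; last lia.
apply: eq_avg => s szs; rewrite walk1 // !size_cat szL szL' szs.
by rewrite (_ : _ == _) //; apply/eqP; lia.
Qed.

Lemma walk_densityD q1 q2 L L' : (0 < q1)%N -> (0 < q2)%N ->
  size L = l -> size L' = l ->
  avg l (fun N => walk_density q1 L N * walk_density q2 N L')
    <= walk_density (q1 + q2) L L'.
Proof.
move=> q10 q20 szL szL'; rewrite {3}/walk_density.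
have q1m : (k - l <= q1 * (k - l))%N by rewrite leq_pmull.
have q2m : (k - l <= q2 * (k - l))%N by rewrite leq_pmull.
rewrite (_ : (q1 + q2) * (k - l) - l =
  q1 * (k - l) - l + (l + (q2 * (k - l) - l)))%N; last by rewrite mulnDl; lia.
rewrite avg_cat; under [leRHS]eq_avg => s _ do rewrite avg_cat.
rewrite [leRHS]avg_swap //; apply: ler_avg => // N szN.
rewrite /walk_density -avgZr; apply: ler_avg => // s szs.
rewrite -avgZ; apply: ler_avg => // t szt.
case w1: (walk l H q1 _); last by rewrite mul0r ler0n.
case w2: (walk l H q2 _); last by rewrite mulr0 ler0n.
rewrite mulr1 ler1n lt0b -!catA [L ++ s ++ _]catA.
by apply: walk_cat => //; rewrite -?catA.
Qed.

Lemma walk_density_uniq L N : size L = l -> size N = l ->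
  0 < walk_density 1 L N -> uniq L /\ uniq N.
Proof.
move=> szL szN w0; have /avg_exists : walk_density 1 L N / 2 <= walk_density 1 L N by lra.
move=> /(_ V_gt0)[s szs]; case w: (walk l H 1 _); last first.
  by rewrite leNgt divr_gt0.
move=> _; split; first exact: walk_uniq_first w.
by move: w; rewrite catA => w; apply: walk_uniq_last w.
Qed.

Lemma walk_density1_avg L : size L = l ->
  avg l (walk_density 1 L) = avg (k - l) (fun s => (spans_edge H (L ++ s))%:R).
Proof.
move=> szL; rewrite (_ : k - l = k - 2 * l + l)%N; last lia.
rewrite [RHS]avg_cat [RHS]avg_swap //; apply: eq_avg => N szN.
exact: walk_density1.
Qed.

Lemma walk_density1C L N : size L = l -> size N = l ->
  walk_density 1 L N = walk_density 1 N L.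
Proof.
move=> szL szN; rewrite !walk_density1 //; apply: eq_avg => s _.
by congr ((nat_of_bool _)%:R); apply: eq_spans_edge => x; rewrite !mem_cat orbCA [RHS]orbC orbA.
Qed.

Definition connected_by (q : nat) (c : R) : Prop :=
  forall L L', uniq L -> uniq L' -> size L = l -> size L' = l ->
    c <= walk_density q L L'.

Lemma connected_byS d c q : 0 <= c -> (0 < q)%N ->
  min_avg_degree l d -> connected_by q c -> connected_by q.+1 (d * c).
Proof.
move=> c0 q0 mdl cq L L' uL uL' szL szL'.
apply: le_trans (walk_densityD (ltn0Sn 0) q0 szL szL').
apply: (@le_trans _ _ (avg l (fun N => walk_density 1 L N * c))).
  by rewrite avgZr walk_density1_avg // ler_wpM2r // mdl.
(* [connected_by] speaks only of repetition-free [N]; any other [N] shares no edge with [L] and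
   contributes 0. *)
apply: ler_avg => // N szN; have := walk_density_ge0 1 L N.
rewrite le_eqVlt => /orP[/eqP<-|w0]; first by rewrite !mul0r.
have [_ uN] := walk_density_uniq szL szN w0.
by rewrite ler_pM2l // cq.
Qed.

End Degrees.

Arguments walk_density {R k} l {V} H q L L'.

(** * Connecting under a codegree condition *)

Section EfronStein.

Variables (R : realType) (V : finType).
Hypothesis V_gt0 : (0 < #|V|)%N.

(** The left side is the probability that [A] holds at one random tuple and fails at an independent
    one. Passing from the first to the second one coordinate at a time, [A] must be lost at some
    coordinate, and each summand is the probability of a loss there. *)
Lemma efron_stein m (A : pred (seq V)) (p : R) :
  p = avg m (fun s => (A s)%:R) ->
  p * (1 - p) <= \sum_(i < m) avg i (fun a => avg 1 (fun u => avg 1 (fun v =>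
    avg (m - i.+1) (fun b => (A (a ++ u ++ b) && ~~ A (a ++ v ++ b))%:R)))).
Proof.
elim: m A p => [|m IH] A p pA; first by rewrite big_ord0 pA avg0; case: (A _); rewrite /= ?subrr ?mulr0 ?mul0r.
pose p_ x : R := avg m (fun s => (A (x ++ s))%:R).
have pE : p = avg 1 p_ by rewrite pA; apply: avg_cons.
have indep : p * (1 - p) = avg 1 (fun u => avg 1 (fun v =>
    avg m (fun b => avg m (fun b' => (A (u ++ b))%:R * (1 - (A (v ++ b'))%:R))))).
  rewrite {1}pE -avgZr; apply: eq_avg => u _.
  rewrite -avgZr pE avg_compl //.
  under eq_avg => b _ do rewrite -avgZ.
  rewrite avg_swap //; apply: eq_avg => v _; apply: eq_avg => b _.
  by rewrite avgZ avg_compl.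
rewrite indep big_ord_recl /= subSS subn0.
under [X in _ + X]eq_bigr => i _ do rewrite avg_cons subSS.
rewrite avg0 -avg_sum //; set G := avg 1 (fun v => p_ v * (1 - p_ v)).
(* If [A] holds at [u ++ b] and fails at [v ++ b'], then it is lost between [u ++ b] and [v ++ b],
   or between [v ++ b] and [v ++ b']; the second event is left to the induction. *)
apply: (@le_trans _ _ (avg 1 (fun u => avg 1 (fun v =>
    avg m (fun b => (A (u ++ b) && ~~ A (v ++ b))%:R))) + G)).
  rewrite -[X in _ + X](avg_const V_gt0 1) -avgD.
  apply: ler_avg => // u _; rewrite -avgD; apply: ler_avg => // v _.
  rewrite -avgZr -avgD; apply: ler_avg => // b _.
  rewrite -(avg_const V_gt0 m (A (u ++ b) && _)%:R) avg_compl // -avgZ -avgD.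
  by apply: ler_avg => // b' _; do 3!case: (A _); rewrite /=; lra.
apply: lerD => //; apply: ler_avg => // v _; apply: le_trans (IH _ _ erefl) _.
apply: ler_sum => i _; rewrite le_eqVlt; apply/orP; left; apply/eqP.
by do 4!apply: eq_avg => ? _; rewrite -!catA.
Qed.

End EfronStein.

(** * Neighbourhoods and reachable sets under the codegree condition *)

Section CodegreeConnection.

Variables (R : realType) (k l : nat) (V : finType) (H : kgraph k V).
Hypothesis V_gt0 : (0 < #|V|)%N.
Hypothesis l2_lt_k : (2 * l < k)%N.

Definition near (eps : R) (L N : seq V) : bool :=
  (eps <= walk_density l H 1 L N)%R.

Lemma nearC eps L N : size L = l -> size N = l -> near eps L N = near eps N L.
Proof. by move=> szL szN; rewrite /near walk_density1C. Qed.

Lemma near_uniq eps L N : 0 < eps -> size L = l -> size N = l ->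
  near eps L N -> uniq N.
Proof.
move=> e0 szL szN eLN.
by have [] := walk_density_uniq V_gt0 l2_lt_k szL szN (lt_le_trans e0 eLN).
Qed.

Lemma avg_near_ge eps c L : 0 <= eps -> min_avg_degree H l c -> uniq L -> size L = l ->
  c - eps <= avg l (fun N => (near eps L N)%:R).
Proof.
move=> e0 mdl uL szL; rewrite lerBlDr; apply: (le_trans (mdl L uL szL)).
rewrite -walk_density1_avg // -[X in _ + X](avg_const V_gt0 l) -avgD.
apply: ler_avg => // N _; rewrite /near.
have := walk_density_le1 R l H V_gt0 1 L N; have := walk_density_ge0 R l H V_gt0 1 L N.
by move: (walk_density _ _ _ _ _) => w; case: (leP eps w) => /=; lra.
Qed.

Lemma avg_near2_le eps L L' : 0 <= eps -> size L = l -> size L' = l ->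
  eps ^+ 2 * avg l (fun P => (near eps L P && near eps P L')%:R)
    <= walk_density l H 2 L L'.
Proof.
move=> e0 szL szL'; apply: le_trans (walk_densityD R H V_gt0 l2_lt_k (ltn0Sn 0) (ltn0Sn 0) szL szL').
rewrite -avgZ; apply: ler_avg => // P szP; rewrite /near.
have w0 := walk_density_ge0 R l H V_gt0 1.
have [w1|_] := boolP (eps <= _); last by rewrite mulr0 mulr_ge0.
have [w2|_] := boolP (eps <= _); last by rewrite mulr0 mulr_ge0.
by rewrite mulr1 expr2 ler_pM.
Qed.

Variables (eta delta eps1 eps c : R).
Hypotheses (delta0 : 0 < delta) (eps10 : 0 < eps1) (eps0 : 0 < eps).
Hypothesis eps_le : eps <= eta.
Hypothesis gap : 3 * delta + eps1 + 2 * delta + 2 * eps < 3 * eta.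
Hypothesis mdl : min_avg_degree H l (1 / 3 + eta).
Hypothesis mdl1 : min_avg_degree H l.+1 (1 / 3 + eta).

Let robust (K N : seq V) : bool :=
  (eps1 <= avg (k - 2 * l - 1) (fun s => (spans_edge H (K ++ s ++ N))%:R))%R.

(** Meant for an (l+1)-tuple [K] and the [l]-tuple [x] left when one entry of [K] is deleted. If
    [zeta K x] is small, almost every tuple joined robustly to [K] is near [x]; if this holds for
    two such tuples, they have many common neighbours. *)
Let zeta (K x : seq V) : R :=
  avg l (fun N => (robust K N && ~~ near eps x N)%:R).

Lemma avg_robust_ge K : uniq K -> size K = l.+1 ->
  1 / 3 + eta - eps1 <= avg l (fun N => (robust K N)%:R).
Proof.
move=> uK szK; rewrite lerBlDr; apply: (le_trans (mdl1 uK szK)).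
rewrite (_ : k - l.+1 = k - 2 * l - 1 + l)%N; last lia.
rewrite avg_cat avg_swap // -[X in _ + X](avg_const V_gt0 l) -avgD.
apply: ler_avg => // N _; rewrite /robust.
set w := avg _ _; have w0 : 0 <= w by apply: avg_ge0 => // s _; rewrite ler0n.
have w1 : w <= 1 by apply: avg_le1 => // s _; rewrite lern1 leq_b1.
have := eps10; move: w0 w1; clearbody w; case: (leP eps1 w) => /=; lra.
Qed.

(** If [N] is not near [x], then fewer than [eps] of the completions of [x] and [N] are edges. This
    density is the average over the added vertex [v] of the density for [K v] and [N], so by
    Markov's inequality at most [eps / eps1] of the [v] make [K v] robust with [N]. *)
Lemma avg_zeta_le (x : seq V) (K : seq V -> seq V) : size x = l ->
  (forall v, perm_eq (K v) (v ++ x)) ->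
  avg 1 (fun v => zeta (K v) x) <= eps / eps1.
Proof.
move=> szx Kx; rewrite /zeta avg_swap // -(avg_const V_gt0 l (_ / _)).
apply: ler_avg => // N szN; rewrite /near.
have [_|lt_eps] := leP eps (walk_density l H 1 x N).
  under eq_avg => v _ do rewrite andbF.
  by rewrite avg_const // divr_ge0 // ltW.
under eq_avg => v _ do rewrite andbT.
rewrite ler_pdivlMr // mulrC.
apply: (le_trans (avg_markov V_gt0 (f := fun v =>
  avg (k - 2 * l - 1) (fun s => (spans_edge H (K v ++ s ++ N))%:R)) _ _)).
  by move=> v _; apply: avg_ge0 => // s _; rewrite ler0n.
apply: le_trans (ltW lt_eps); rewrite walk_density1 //.
rewrite [in leRHS](_ : k - 2 * l = 1 + (k - 2 * l - 1))%N; last lia.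
rewrite avg_cat; apply: ler_avg => // v _; apply: ler_avg => // s _.
rewrite ler_nat (@perm_spans_edge _ _ _ _ (x ++ (v ++ s) ++ N)) //.
apply: (perm_trans (y := (v ++ x) ++ s ++ N)); first by rewrite perm_cat2r.
by rewrite -!catA perm_catCA.
Qed.

Section Pair.

Variables (L L' : seq V).
Hypotheses (uL : uniq L) (uL' : uniq L') (szL : size L = l) (szL' : size L' = l).

Let common (M N : seq V) : R := avg l (fun P => (near eps M P && near eps P N)%:R).

Let reach (M N : seq V) : bool := (delta <= common M N)%R.

(** The negation of the bound proved in [common_near_ge], assumed throughout this section in order
    to be refuted. *)
Hypothesis few : avg l (fun N => common L N * common L' N) < c.
Hypotheses (c_le : c <= (delta / 3) ^+ 2).

Lemma near_deg M : uniq M -> size M = l ->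
  1 / 3 + eta - eps <= avg l (fun N => (near eps M N)%:R).
Proof. by apply: avg_near_ge => //; apply: ltW. Qed.

Let third M : uniq M -> size M = l ->
  1 / 3 <= avg (R := R) l (fun N => (near eps M N)%:R).
Proof. by move=> uM szM; apply: le_trans (near_deg uM szM); have := eps_le; lra. Qed.

Let common_ge0 M N : 0 <= common M N.
Proof. by apply: avg_ge0 => // s _; rewrite ler0n. Qed.

Let common_le1 M N : common M N <= 1.
Proof. by apply: avg_le1 => // s _; rewrite lern1 leq_b1. Qed.

(** Otherwise let [Q] be the set of tuples near both [L] and [L'], and [q N] the density of its
    members near [N]. Each member is near a third of all tuples, so [q] has mean at least
    [delta / 3], and by Cauchy-Schwarz its mean square is at least [c]. But [q N] is below both
    common-neighbour densities, which contradicts [few]. *)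
Lemma disjoint_near : avg l (fun P => (near eps L P && near eps L' P)%:R) < delta.
Proof.
rewrite ltNge; apply/negP => le_d; have := few; apply/negP; rewrite -leNgt.
apply: (le_trans c_le); set Q := fun P => near eps L P && near eps L' P.
pose q N : R := avg l (fun P => (Q P && near eps P N)%:R).
have q0 N : 0 <= q N by apply: avg_ge0 => // s _; rewrite ler0n.
have le_q : delta / 3 <= avg l q.
  rewrite /q avg_swap //; apply: (le_trans (y := avg l (fun P => (Q P)%:R) * (1 / 3))).
    by rewrite mulrA mulr1 ler_pM2r ?invr_gt0.
  rewrite -avgZr; apply: ler_avg => // P szP; case QP: (Q P); last first.
    by rewrite mul0r; apply: avg_ge0 => // s _; rewrite ler0n.
  rewrite mul1r; apply: third => //.
  by case/andP: QP => LP _; apply: near_uniq LP.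
apply: (@le_trans _ _ (avg l (fun N => q N ^+ 2))).
  apply: le_trans (avg_CS V_gt0 _ _); rewrite lerXn2r ?nnegrE //.
    by rewrite divr_ge0 // ltW.
  by apply: avg_ge0.
apply: ler_avg => // N _; rewrite expr2; apply: ler_pM => //; apply: ler_avg => // P _;
  rewrite ler_nat /Q.
- by case: (near eps L P); case: (near _ _ _).
- by case: (near eps L P) => //; case: (near _ _ _) => //; case: (near _ _ _).
Qed.

(** A third of all tuples is near [M], and each of these is near a third in turn, so the mean of
    [common M] is at least 1/9; tuples that are not reached account for at most [delta] of it. *)
Lemma reach_ge M : uniq M -> size M = l ->
  1 / 9 - delta <= avg l (fun N => (reach M N)%:R).
Proof.
move=> uM szM; rewrite lerBlDr -[X in _ + X](avg_const V_gt0 l) -avgD.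
apply: (@le_trans _ _ (avg l (common M))); last first.
  apply: ler_avg => // N _; rewrite /reach; have := common_le1 M N.
  by have := delta0; case: (leP delta (common M N)) => /=; lra.
rewrite /common avg_swap //; apply: (@le_trans _ _ (avg l (fun P => (near eps M P)%:R) * (1 / 3))).
  have := third uM szM; lra.
rewrite -avgZr; apply: ler_avg => // P szP; case MP: (near eps M P); last first.
  by rewrite mul0r; apply: avg_ge0 => // s _; rewrite ler0n.
by rewrite mul1r; apply: third => //; move: MP; apply: near_uniq.
Qed.

Lemma reach_both : avg l (fun N => (reach L N && reach L' N)%:R) <= c / delta ^+ 2.
Proof.
rewrite ler_pdivlMr ?exprn_gt0 // mulrC -avgZ; apply: le_trans (ltW few).
apply: ler_avg => // N _; rewrite /reach.
have [le1|_] := boolP (delta <= _); last by rewrite mulr0 mulr_ge0.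
have [le2|_] := boolP (delta <= _); last by rewrite mulr0 mulr_ge0.
by rewrite mulr1 expr2; apply: ler_pM => //; apply: ltW.
Qed.

(* The sets of tuples near L, near L' and near both x and y have density
   above 1/3, so two of them meet. *)
Lemma reach_step K x y : uniq K -> size K = l.+1 -> size x = l -> size y = l ->
  zeta K x < delta -> zeta K y < delta ->
  reach L x -> reach L y || reach L' x.
Proof.
move=> uK szK szx szy zx zy Lx; apply/negPn/negP; rewrite negb_or => /andP[Ly L'x].
pose S P := near eps x P && near eps y P.
have leS : 1 / 3 + eta - eps1 - 2 * delta <= avg l (fun P => (S P)%:R).
  rewrite lerBlDr; apply: (le_trans (avg_robust_ge uK szK)).
  apply: (@le_trans _ _ (avg l (fun P => (S P)%:R) + zeta K x + zeta K y)); last lra.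
  rewrite /zeta -!avgD; apply: ler_avg => // P _; rewrite -!natrD ler_nat /S.
  by case: (robust K P); case: (near eps x P); case: (near eps y P).
(* [S] consists of neighbours of [y], which [L] does not reach, and of neighbours of [x], which [L']
   does not reach. *)
have SL : avg l (fun P => (S P && near eps L P)%:R) < delta.
  move: Ly; rewrite /reach -ltNge; apply: le_lt_trans.
  apply: ler_avg => // P szP; rewrite ler_nat /S [near eps P y]nearC //.
  by case: (near eps x P); case: (near eps y P); case: (near eps L P).
have SL' : avg l (fun P => (S P && near eps L' P)%:R) < delta.
  move: L'x; rewrite /reach -ltNge; apply: le_lt_trans.
  apply: ler_avg => // P szP; rewrite ler_nat /S [near eps P x]nearC //.
  by case: (near eps x P); case: (near eps y P); case: (near eps L' P).
(* The three densities add up to at least 1 + 3 eta - eps1 - 2 delta - 2 eps, while their pairwise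
   intersections add up to less than 3 delta; [gap] makes this impossible. *)
have := disjoint_near; have := near_deg uL szL; have := near_deg uL' szL'.
have : avg l (fun P => (S P)%:R) + avg l (fun P => (near eps L P)%:R) +
       avg l (fun P => (near eps L' P)%:R) <=
       1 + avg l (fun P => (S P && near eps L P)%:R) +
       avg l (fun P => (S P && near eps L' P)%:R) +
       avg l (fun P => (near eps L P && near eps L' P)%:R) :> R.
  rewrite -[X in _ <= X + _ + _ + _](avg_const V_gt0 l) -!avgD; apply: ler_avg => // P _.
  rewrite -!natrD (_ : 1 = 1%:R) // -!natrD ler_nat.
  by case: (S P); case: (near eps L P); case: (near eps L' P).
have := gap; lra.
Qed.

(** With [x] and [y] differing in one entry and [K] their union, [reach_step] applies unless [K] has
    a repetition or one of the two [zeta] values is large. Outside these exceptions, reaching [x]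
    but not [y] from [L] forces [x] to be reached from [L'] too, which is rare by [reach_both]. *)
Lemma reach_crossing i : (i < l)%N ->
  avg i (fun a => avg 1 (fun u => avg 1 (fun v => avg (l - i.+1) (fun b =>
    (reach L (a ++ u ++ b) && ~~ reach L (a ++ v ++ b))%:R)))) <=
  (l.+1 * l.+1)%:R / #|V|%:R + 2 * (eps / eps1 / delta) + c / delta ^+ 2.
Proof.
move=> il; have szE : (i + (1 + (l - i.+1)) = l)%N by lia.
pose K a u v b : seq V := a ++ u ++ v ++ b.
pose f1 a u v b : R := (~~ uniq (K a u v b))%:R.
pose f2 a u v b : R := (delta <= zeta (K a u v b) (a ++ u ++ b))%R%:R.
pose f3 a u v b : R := (delta <= zeta (K a u v b) (a ++ v ++ b))%R%:R.
pose f4 a u b : R := (reach L (a ++ u ++ b) && reach L' (a ++ u ++ b))%:R.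
apply: (@le_trans _ _ (avg i (fun a => avg 1 (fun u => avg 1 (fun v =>
    avg (l - i.+1) (fun b => f1 a u v b + f2 a u v b + f3 a u v b + f4 a u b)))))).
  apply: ler_avg => // a sza; apply: ler_avg => // u szu.
  apply: ler_avg => // v szv; apply: ler_avg => // b szb; rewrite /f1 /f2 /f3 /f4.
  set x := a ++ u ++ b; set y := a ++ v ++ b.
  have [uK|nK] := boolP (uniq _); last first.
    by rewrite -!natrD ler_nat (leq_trans (leq_b1 _)).
  have [zx|zx] := leP delta (zeta _ x).
    by rewrite -!natrD ler_nat (leq_trans (leq_b1 _)).
  have [zy|zy] := leP delta (zeta _ y).
    by rewrite -!natrD ler_nat (leq_trans (leq_b1 _)).
  rewrite -!natrD ler_nat !add0n; case Lx: (reach L x) => //=.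
  have := reach_step uK _ _ _ zx zy Lx; rewrite !size_cat sza szu szv szb.
  by rewrite [(i + (1 + (1 + _)))%N]addnCA szE => /(_ erefl erefl erefl); case: (reach L y) => //= ->.
under eq_avg => a _ do under eq_avg => u _ do under eq_avg => v _ do rewrite !avgD.
under eq_avg => a _ do under eq_avg => u _ do rewrite !avgD avg_const //.
under eq_avg => a _ do rewrite !avgD; rewrite !avgD.
rewrite mulr2n mulrDl !mul1r addrA; apply: lerD; first apply: lerD; first apply: lerD.
- apply: le_trans (avg_nuniq_le R V_gt0 l.+1); rewrite [in leRHS](_ : l.+1 = i + (1 + (1 + (l - i.+1))))%N; last lia.
  rewrite avg_cat; apply: ler_avg => // a _; rewrite avg_cat; apply: ler_avg => // u _.
  by rewrite avg_cat.
- rewrite -[leRHS](avg_const V_gt0 i); apply: ler_avg => // a sza.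
  rewrite -[leRHS](avg_const V_gt0 1); apply: ler_avg => // u szu.
  rewrite avg_swap // -[leRHS](avg_const V_gt0 (l - i.+1)); apply: ler_avg => // b szb.
  rewrite ler_pdivlMr // mulrC.
  apply: (le_trans (avg_markov V_gt0 (f := fun v => zeta (K a u v b) (a ++ u ++ b)) _ _)).
    by move=> v _; apply: avg_ge0 => // s _; rewrite ler0n.
  apply: avg_zeta_le => [|v]; first by rewrite !size_cat sza szu szb; lia.
  by rewrite /K perm_sym perm_catCA perm_cat2l perm_catCA.
- rewrite -[leRHS](avg_const V_gt0 i); apply: ler_avg => // a sza.
  rewrite avg_swap // -[leRHS](avg_const V_gt0 1); apply: ler_avg => // v szv.
  rewrite avg_swap // -[leRHS](avg_const V_gt0 (l - i.+1)); apply: ler_avg => // b szb.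
  rewrite ler_pdivlMr // mulrC.
  apply: (le_trans (avg_markov V_gt0 (f := fun u => zeta (K a u v b) (a ++ v ++ b)) _ _)).
    by move=> u _; apply: avg_ge0 => // s _; rewrite ler0n.
  apply: avg_zeta_le => [|u]; first by rewrite !size_cat sza szv szb; lia.
  by rewrite /K perm_sym perm_catCA.
- apply: le_trans reach_both; rewrite -[in leRHS]szE avg_cat; apply: ler_avg => // a _.
  by rewrite avg_cat.
Qed.

End Pair.

(** If the bound failed, the set reached from [L] would have density [p] at least 1/9 - 1/90 = 1/10.
    Hardly anything would be reached from both sides, so [1 - p] would be at least 1/20 because of
    the set reached from [L']. Then [p * (1 - p)] is at least 1/200, but [efron_stein] and
    [reach_crossing] bound it by 1/400. *)
Lemma common_near_ge L L' : uniq L -> uniq L' -> size L = l -> size L' = l ->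
  (0 < l)%N -> delta <= 1 / 90 -> c <= (delta / 3) ^+ 2 ->
  c / delta ^+ 2 <= 1 / (800 * l%:R) ->
  (l.+1 * l.+1)%:R / #|V|%:R + 2 * (eps / eps1 / delta) <= 1 / (800 * l%:R) ->
  c <= avg l (fun N => avg l (fun P => (near eps L P && near eps P N)%:R) *
                       avg l (fun P => (near eps L' P && near eps P N)%:R)).
Proof.
move=> uL uL' szL szL' l0 d90 c_le c_small atyp; rewrite leNgt; apply/negP => few.
have lR : 0 < l%:R :> R by rewrite ltr0n.
set p : R := avg l (fun N => (delta <= avg l
  (fun P => (near eps L P && near eps P N)%:R : R))%R%:R).
have es := efron_stein V_gt0 (erefl p).
have : p * (1 - p) <= \sum_(i < l) (1 / (400 * l%:R)).
  apply: (le_trans es); apply: ler_sum => i _.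
  apply: (le_trans (reach_crossing uL uL' szL szL' few c_le (ltn_ord i))).
  have -> : 1 / (400 * l%:R) = 1 / (800 * l%:R) + 1 / (800 * l%:R) :> R.
    by field; rewrite gt_eqF.
  exact: lerD.
rewrite sumr_const card_ord -[_ *+ l]mulr_natr.
have -> : 1 / (400 * l%:R) * l%:R = 1 / 400 :> R by field; rewrite gt_eqF.
have p1 : 1 / 9 - delta <= p := reach_ge uL szL.
have := reach_ge uL' szL'; set p' := avg _ _ => p2.
have pp : p' <= 1 - p + c / delta ^+ 2.
  apply: le_trans (lerD (lexx _) (reach_both few)).
  rewrite /p avg_compl // -avgD; apply: ler_avg => // N _.
  move: (delta <= _)%R (delta <= _)%R => [] []; by rewrite /= ?subrr ?addr0 ?add0r ?subr0 ?lexx ?ler01.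
have le800 : 1 / (800 * l%:R) <= 1 / 800 :> R.
  by rewrite !div1r lef_pV2 ?posrE ?mulr_gt0 // ler_peMr ?ler1n.
have p3 : 1 / 10 <= p by lra.
have p4 : 1 / 20 <= 1 - p by lra.
by have := ler_pM _ _ p3 p4; lra.
Qed.

End CodegreeConnection.

(** The four edges are two walks of two edges that meet in a common middle tuple [N]; each of them
    passes through a tuple near both of its ends. *)
Lemma codegree_connected (R : realType) (k l : nat) (eta : R) :
  (0 < l)%N -> (2 * l < k)%N -> 0 < eta ->
  exists2 c : R, 0 < c & exists n0 : nat,
    forall (V : finType) (H : kgraph k V), (n0 <= #|V|)%N ->
      min_avg_degree H l (1 / 3 + eta) -> min_avg_degree H l.+1 (1 / 3 + eta) ->
      connected_by l H 4 c.
Proof.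
move=> l0 lk eta0; have lR : 0 < l%:R :> R by rewrite ltr0n.
(* With [d], [e1] and [e] at most [eta / 10], the losses 5d + e1 + 2e stay below 3 eta. *)
pose d : R := Num.min (eta / 10) (1 / 90).
have d0 : 0 < d by rewrite lt_min divr_gt0 //= divr_gt0.
have de : d <= eta / 10 by rewrite ge_min lexx.
have d90 : d <= 1 / 90 by rewrite ge_min lexx orbT.
pose e1 := eta / 10; have e10 : 0 < e1 by rewrite divr_gt0.
(* Chosen so that [2 * (x / e1 / d)] is exactly [1 / (1600 * l%:R)], half of the error allowed; the
   repetition term takes the other half, which explains the bound on the number of vertices
   below. *)
pose x := e1 * d / (3200 * l%:R).
have x0 : 0 < x by rewrite divr_gt0 // mulr_gt0.
pose e := Num.min (eta / 10) x.
have e0 : 0 < e by rewrite lt_min divr_gt0 //=.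
have ee : e <= eta / 10 by rewrite ge_min lexx.
have ex : e <= x by rewrite ge_min lexx orbT.
pose c := d ^+ 2 / (800 * l%:R).
have c0 : 0 < c by rewrite divr_gt0 ?mulr_gt0 ?exprn_gt0.
exists (e ^+ 4 * c); first by rewrite mulr_gt0 ?exprn_gt0.
exists (1600 * l * (l.+1 * l.+1))%N => V H nV mdl mdl1 L L' uL uL' szL szL'.
have V0 : (0 < #|V|)%N by apply: leq_trans nV; rewrite !muln_gt0 l0.
apply: le_trans (walk_densityD R H V0 lk (q1 := 2) (q2 := 2) isT isT szL szL').
apply: (@le_trans _ _ (avg l (fun N =>
  (e ^+ 2 * avg l (fun P => (near l H e L P && near l H e P N)%:R)) *
  (e ^+ 2 * avg l (fun P => (near l H e L' P && near l H e P N)%:R))))).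
  under eq_avg => N _ do rewrite mulrACA -exprD.
  rewrite avgZ ler_pM2l ?exprn_gt0 //.
  apply: (common_near_ge V0 lk (eta := eta) (delta := d) (eps1 := e1)) => //.
  - by rewrite /e1; lra.
  - by rewrite /e1; lra.
  - rewrite /c expr_div_n ler_pM2l ?exprn_gt0 // lef_pV2 ?posrE ?mulr_gt0 ?exprn_gt0 //.
    have l1 : 1 <= l%:R :> R by rewrite ler1n.
    lra.
  - by rewrite /c mulrAC mulfV ?gt_eqF ?exprn_gt0.
  have -> : 1 / (800 * l%:R) = 1 / (1600 * l%:R) + 1 / (1600 * l%:R) :> R.
    by field; rewrite gt_eqF.
  apply: lerD.
    by rewrite div1r ler_pdivrMr ?ltr0n // ler_pdivlMl ?mulr_gt0 // -!natrM ler_nat.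
  have -> : 1 / (1600 * l%:R) = 2 * (x / e1 / d).
    by rewrite /x; field; rewrite !gt_eqF.
  by rewrite ler_pM2l // ler_pM2r ?invr_gt0 // ler_pM2r ?invr_gt0.
apply: ler_avg => // N szN; apply: ler_pM.
- by rewrite mulr_ge0 ?sqr_ge0 //; apply: avg_ge0 => // s _; rewrite ler0n.
- by rewrite mulr_ge0 ?sqr_ge0 //; apply: avg_ge0 => // s _; rewrite ler0n.
- by apply: avg_near2_le => //; apply: ltW.
apply: le_trans (avg_near2_le H V0 lk (ltW e0) szN szL').
rewrite ler_pM2l ?exprn_gt0 //; apply: ler_avg => // P szP.
by rewrite andbC nearC // [near _ _ _ L' P]nearC.
Qed.

(** * Connecting under a degree condition *)

Section LoomisWhitney.

Variables (R : realType) (V : finType).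
Hypothesis V_gt0 : (0 < #|V|)%N.

Lemma rootXn (c : R) n : 0 <= c -> (0 < n)%N -> exists2 s : R, 0 <= s & s ^+ n = c.
Proof.
move=> c0 n0; exists (c `^ (n%:R^-1)); first exact: powR_ge0.
by rewrite -powR_mulrn ?powR_ge0 // -powRrM mulVf ?powRr1 // pnatr_eq0 -lt0n.
Qed.

Let avgb_ge0 m (A : pred (seq V)) : 0 <= avg (R := R) m (fun s => (A s)%:R).
Proof. by apply: avg_ge0 => // s _; rewrite ler0n. Qed.

(** Induction on the dimension. The slice of [A] at a first entry [x] has density at most that of
    [B], by deleting [x], and is bounded by the slice of [B] at [x], by induction. Multiplying the
    two bounds gives slice of [A] <= [s] * slice of [B], with [s] the root of order m+2 of the
    density of [B], and this can be averaged over [x]. *)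
Lemma loomis_whitney m (A B : pred (seq V)) :
  (forall s x t, A (s ++ x :: t) -> B (s ++ t)) ->
  avg (R := R) m.+2 (fun s => (A s)%:R) ^+ m.+1 <= avg m.+1 (fun s => (B s)%:R) ^+ m.+2.
Proof.
elim: m A B => [|m IH] A B AB.
  rewrite expr1 expr2 avg_cons -avgZr; apply: ler_avg => // -[//|x [|//]] _.
  rewrite -avgZ; apply: ler_avg => // -[//|y [|//]] _.
  rewrite -natrM ler_nat mulnb; case Axy: (A _) => //.
  by have := AB [::] x [:: y] Axy; have := AB [:: x] y [::] Axy => /= -> ->.
set c : R := avg m.+2 (fun s => (B s)%:R).
have c0 : 0 <= c by apply: avgb_ge0.
have [s s0 sE] := rootXn c0 (ltn0Sn m.+1).
have le_ab x : avg m.+2 (fun t => (A (x :: t))%:R) <=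
    s * avg m.+1 (fun t => (B (x :: t))%:R).
  rewrite -(ler_pXn2r (ltn0Sn m.+1)) ?nnegrE ?mulr_ge0 ?avgb_ge0 //.
  rewrite [leRHS]exprMn sE [leLHS]exprS.
  apply: ler_pM; rewrite ?exprn_ge0 ?avgb_ge0 //.
    apply: ler_avg => // t _; rewrite ler_nat; case Axt: (A _) => //.
    by rewrite (AB [::] x t).
  by apply: IH => t y u; apply: (AB (x :: t) y u).
have : avg m.+3 (fun t => (A t)%:R) <= s * c.
  rewrite [leLHS]avg_cons /c [in leRHS]avg_cons -avgZ; apply: ler_avg => // -[//|x [|//]] _.
  exact: le_ab.
rewrite -(ler_pXn2r (ltn0Sn m.+1)) ?nnegrE ?mulr_ge0 ?avgb_ge0 // => le_sc.
by apply: (le_trans le_sc); rewrite exprMn sE -exprS.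
Qed.

(** Kruskal-Katona for a property closed under deleting entries: [loomis_whitney] is applied at each
    length from [m] down to [l], and the exponents telescope. *)
Lemma shadow_density (G : pred (seq V)) l m : (0 < l <= m)%N ->
  (forall s x t, G (s ++ x :: t) -> G (s ++ t)) ->
  avg (R := R) m (fun s => (G s)%:R) ^+ l <= avg l (fun s => (G s)%:R) ^+ m.
Proof.
case/andP => l0 lm GG; elim: m lm => [|m IH]; first by rewrite leqn0 => /eqP l_0; rewrite l_0 in l0.
rewrite leq_eqVlt => /orP[/eqP-> //|]; rewrite ltnS => lm.
have m0 : (0 < m)%N by apply: leq_trans lm.
have lw : avg m.+1 (fun s => (G s)%:R) ^+ m <= avg m (fun s => (G s)%:R) ^+ m.+1 :> R.
  by case: (m) m0 => // m' _; apply: loomis_whitney.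
rewrite -(ler_pXn2r m0) ?nnegrE ?exprn_ge0 ?avgb_ge0 // exprAC.
apply: (le_trans (y := (avg m (fun s => (G s)%:R) ^+ m.+1) ^+ l)).
  by rewrite lerXn2r ?nnegrE ?exprn_ge0 ?avgb_ge0.
rewrite exprAC [leRHS]exprAC lerXn2r ?nnegrE ?exprn_ge0 ?avgb_ge0 //.
exact: IH.
Qed.

(** The entries of a random tuple at the positions marked by [mu] and those at the other positions
    are independent. *)
Lemma avg_mask (mu : bitseq) (phi : seq V -> seq V -> R) :
  avg (size mu) (fun s => phi (mask mu s) (mask (map negb mu) s)) =
  avg (count id mu) (fun N => avg (count negb mu) (phi N)).
Proof.
elim: mu phi => [|[] mu IH] phi; first (by rewrite !avg0); rewrite [size _]/= [count id _]/= [count negb _]/=.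
  rewrite add0n add1n [LHS]avg_cons [RHS]avg_cons.
  apply: eq_avg => -[//|x [|//]] _.
  exact: (IH (fun N => phi (x :: N))).
rewrite add0n add1n [LHS]avg_cons; under [RHS]eq_avg => N _ do rewrite avg_cons.
rewrite [RHS]avg_swap //; apply: eq_avg => -[//|x [|//]] _.
exact: (IH (fun N M => phi N (x :: M))).
Qed.

Lemma mem_mask_cat (mu : bitseq) (s : seq V) : size mu = size s ->
  s =i mask (map negb mu) s ++ mask mu s.
Proof.
elim: mu s => [|b mu IH] [|x s] //= [sz] y.
by rewrite inE IH //; case: b; rewrite /= !mem_cat ?inE ?mem_cat orbCA // orbA.
Qed.

End LoomisWhitney.

Lemma exprDn_ge (R : realType) (x y : R) n : 0 <= x -> 0 <= y -> (0 < n)%N ->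
  x ^+ n + y ^+ n <= (x + y) ^+ n.
Proof.
move=> x0 y0; elim: n => [//|[|n] IH] _; first by rewrite !expr1.
rewrite [leRHS]exprS; apply: le_trans (ler_wpM2l (addr_ge0 x0 y0) (IH isT)).
rewrite mulrDl !mulrDr -!exprS -addrA lerD2l addrA -[leLHS]add0r lerD2r.
by rewrite addr_ge0 // mulr_ge0 // exprn_ge0.
Qed.

Lemma exprB_le (R : realType) (x y : R) n : 0 <= x -> x <= y -> y <= 1 ->
  y ^+ n <= x ^+ n + n%:R * (y - x).
Proof.
move=> x0 xy y1; elim: n => [|n IH]; first by rewrite mul0r addr0.
have y0 : 0 <= y by apply: le_trans xy.
rewrite exprS; apply: le_trans (ler_wpM2l y0 IH) _.
rewrite exprS mulrDr -[n.+1]addn1 natrD mulrDl mul1r.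
have -> : y * x ^+ n = x * x ^+ n + (y - x) * x ^+ n by ring.
rewrite -addrA lerD2l addrC lerD //.
  by rewrite ler_piMl // mulr_ge0 // subr_ge0.
by rewrite ler_piMr ?subr_ge0 // exprn_ile1 // (le_trans xy).
Qed.

(** * Neighbourhoods of density above one half *)

Section KruskalKatonaConnection.

Variables (R : realType) (k l : nat) (V : finType) (H : kgraph k V).
Hypothesis V_gt0 : (0 < #|V|)%N.
Hypothesis l2_lt_k : (2 * l < k)%N.
Hypothesis l_gt0 : (0 < l)%N.

(** [G] holds for the tuples all of whose subsequences of length [l] are near [L], a property closed
    under deletion. Almost every tuple completing [L] to an edge satisfies it, so its density at
    length [k - l] is nearly [d]; [shadow_density] carries this down to length [l]. *)
Lemma near_shadow (eps d : R) L : 0 < eps -> min_avg_degree H l d ->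
  2 ^+ (k - l) * eps <= d ->
  uniq L -> size L = l ->
  (d - 2 ^+ (k - l) * eps) ^+ l <= avg l (fun N => (near l H eps L N)%:R) ^+ (k - l).
Proof.
move=> e0 mdl ed uL szL.
pose G s := `[< forall N, subseq N s -> size N = l -> near l H eps L N >].
have GG s x t : G (s ++ x :: t) -> G (s ++ t).
  move=> /asboolP h; apply/asboolP => N Nst; apply: h; apply: subseq_trans Nst _.
  by rewrite subseq_cat2l subseq_cons.
have lm : (0 < l <= k - l)%N by lia.
have G0 m : 0 <= avg m (fun s => (G s)%:R) :> R.
  by apply: avg_ge0 => // s _; rewrite ler0n.
apply: (@le_trans _ _ (avg (k - l) (fun s => (G s)%:R) ^+ l)); last first.
  apply: (le_trans (shadow_density R V_gt0 lm GG)); rewrite lerXn2r ?nnegrE //.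
    by apply: avg_ge0 => // s _; rewrite ler0n.
  apply: ler_avg => // N szN; rewrite ler_nat; case GN: (G N) => //.
  by move/asboolP: GN => ->.
rewrite lerXn2r ?nnegrE ?subr_ge0 // lerBlDr; apply: (le_trans (mdl L uL szL)).
(* A completing tuple outside [G] has [l] positions, marked by [mu], whose entries are not near [L].
   For a fixed [mu] such tuples have density at most [eps], and there are at most [2 ^ (k - l)]
   choices of [mu]. *)
pose bad (mu : (k - l).-tuple bool) s : R :=
  (spans_edge H (L ++ s) && ~~ near l H eps L (mask mu s))%:R.
apply: (@le_trans _ _ (avg (k - l) (fun s => (G s)%:R) +
    avg (k - l) (fun s => \sum_(mu : (k - l).-tuple bool | count id mu == l) bad mu s))).
  rewrite -avgD; apply: ler_avg => // s szs.
  have S0 : 0 <= \sum_(mu : (k - l).-tuple bool | count id mu == l) bad mu s.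
    by apply: sumr_ge0 => mu _; rewrite ler0n.
  have [_|nG] := boolP (G s); first by rewrite ler_wpDr // ler_nat leq_b1.
  rewrite add0r; have [Ls|] := boolP (spans_edge H (L ++ s)); last by [].
  move/asboolP: nG => /existsNP[N /not_implyP[Ns /not_implyP[szN nN]]].
  have /subseqP[mu szmu Nmu] := Ns.
  have szmu' : size mu == (k - l)%N by rewrite szmu szs.
  rewrite (bigD1 (Tuple szmu')) /=; last by rewrite -(size_mask szmu) -Nmu szN.
  rewrite /bad Ls /= -Nmu; move/negP: nN => ->; rewrite ler_wpDr //.
  by apply: sumr_ge0 => ? _; rewrite ler0n.
rewrite lerD2l avg_sum //; apply: (@le_trans _ _ (\sum_(mu : (k - l).-tuple bool) eps)); last first.
  by rewrite sumr_const card_tuple card_bool -[leLHS]mulr_natl natrX.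
rewrite big_mkcond; apply: ler_sum => mu _; case: eqP => [cmu|_]; last exact: ltW.
have szmu : size mu = (k - l)%N by rewrite size_tuple.
have cnmu : count negb mu = (k - 2 * l)%N.
  have := count_predC id mu; rewrite szmu cmu (eq_count (a2 := negb)) => [|[]] //; lia.
rewrite /bad -{1}szmu.
pose phi N M : R := (spans_edge H (L ++ M ++ N) && ~~ near l H eps L N)%:R.
rewrite (@eq_avg _ _ _ _ (fun s => phi (mask mu s) (mask (map negb mu) s))).
  rewrite avg_mask // cmu cnmu -(avg_const V_gt0 l eps); apply: ler_avg => // N szN.
  rewrite /phi; have [_|] := boolP (near l H eps L N).
    by under eq_avg => M _ do rewrite andbF; rewrite avg_const // ltW.
  rewrite /near -ltNge walk_density1 // => /ltW; apply: le_trans.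
  by under eq_avg => M _ do rewrite andbT.
move=> s szs; rewrite /phi; congr ((nat_of_bool (_ && _))%:R).
apply: eq_spans_edge => x; rewrite !mem_cat; congr (_ || _).
by rewrite -mem_cat; apply: mem_mask_cat; rewrite szs.
Qed.

End KruskalKatonaConnection.

(** The exponent is chosen so that a^l = (1/2)^(k-l). By [near_shadow] a neighbourhood of density h
    satisfies h^(k-l) >= (a + eta/2)^l >= (1/2)^(k-l) + (eta/2)^l, so h exceeds 1/2 by a constant
    and any two neighbourhoods overlap. *)
Lemma degree_connected (R : realType) (k l : nat) (eta : R) :
  (0 < l)%N -> (2 * l < k)%N -> 0 < eta ->
  exists2 c : R, 0 < c & forall (V : finType) (H : kgraph k V), (0 < #|V|)%N ->
      min_avg_degree H l ((1 / 2) `^ ((k - l)%:R / l%:R) + eta) ->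
      connected_by l H 4 c.
Proof.
move=> l0 lk eta0; have m0 : (0 < k - l)%N by lia.
set a : R := (1 / 2) `^ _; have a0 : 0 <= a by apply: powR_ge0.
have aE : a ^+ l = (1 / 2) ^+ (k - l).
  rewrite /a -powR_mulrn ?powR_ge0 // -powRrM divfK ?pnatr_eq0 -?lt0n //.
  by rewrite powR_mulrn // divr_ge0.
pose eps : R := eta / 2 / 2 ^+ (k - l).
have eps0 : 0 < eps by rewrite !divr_gt0 // exprn_gt0.
have epsE : 2 ^+ (k - l) * eps = eta / 2.
  by rewrite /eps mulrC divfK // gt_eqF // exprn_gt0.
pose xi : R := (eta / 2) ^+ l; have xi0 : 0 < xi by rewrite exprn_gt0 // divr_gt0.
(* Small enough that raising 1/2 by [e2] raises its power of order k-l by less than [xi]; at most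
   1/2, so that [exprB_le] applies to [1 / 2 + e2]. *)
pose e2 : R := Num.min (1 / 2) (xi / (2 * (k - l)%:R)).
have e20 : 0 < e2 by rewrite lt_min divr_gt0 //= divr_gt0 // mulr_gt0 // ltr0n.
have e2h : e2 <= 1 / 2 by rewrite ge_min lexx.
have e2x : (k - l)%:R * e2 < xi.
  apply: (@le_lt_trans _ _ (xi / 2)); last by rewrite ltr_pdivrMr // mulr_natr mulr2n ltrDl.
  have -> : xi / 2 = (k - l)%:R * (xi / (2 * (k - l)%:R)).
    by field; rewrite pnatr_eq0 -lt0n.
  by rewrite ler_pM2l ?ltr0n // ge_min lexx orbT.
exists ((a + eta) * ((a + eta) * (eps ^+ 2 * (2 * e2)))).
  have ae : 0 < a + eta by rewrite ltr_wpDl.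
  by do 2!rewrite mulr_gt0 //; rewrite mulr_gt0 ?exprn_gt0 // mulr_gt0.
move=> V H V0 mdl.
have half L : uniq L -> size L = l -> 1 / 2 + e2 <= avg l (fun N => (near l H eps L N)%:R).
  move=> uL szL; rewrite leNgt; apply/negP => lt_half.
  have := near_shadow V0 lk l0 eps0 mdl; rewrite epsE.
  have -> : a + eta - eta / 2 = a + eta / 2 by lra.
  have le_eta : eta / 2 <= a + eta.
    by rewrite -[leLHS]add0r lerD // ler_pdivrMr // mulr_natr mulr2n lerDl ltW.
  move=> /(_ L le_eta uL szL) sh.
  have eta20 : 0 <= eta / 2 by rewrite divr_ge0 // ltW.
  have := le_trans (exprDn_ge a0 eta20 l0) sh; rewrite aE leNgt => /negP; apply.
  apply: (@le_lt_trans _ _ ((1 / 2 + e2) ^+ (k - l))).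
    apply: lerXn2r (ltW lt_half); rewrite nnegrE.
      by apply: avg_ge0 => // s _; rewrite ler0n.
    by rewrite addr_ge0 ?divr_ge0 // ltW.
  apply: (le_lt_trans (exprB_le (x := 1 / 2) _ _ _ _)); rewrite ?divr_ge0 //; try lra.
  by rewrite ltrD2l; have -> : 1 / 2 + e2 - 1 / 2 = e2 by lra.
(* A common neighbour gives a walk with two edges; two further edges are put in front to arrive at
   the same length four as in the codegree case. *)
have mdl0 := mdl.
apply: connected_byS mdl0 _ => //.
  rewrite mulr_ge0 ?addr_ge0 //; first exact: ltW.
  by rewrite mulr_ge0 ?sqr_ge0 // mulr_ge0 // ltW.
apply: connected_byS mdl _ => //; first by rewrite mulr_ge0 ?sqr_ge0 // mulr_ge0 // ltW.
move=> L L' uL uL' szL szL'.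
apply: le_trans (avg_near2_le H V0 lk (ltW eps0) szL szL').
rewrite ler_pM2l ?exprn_gt0 //.
have := half _ uL szL; have := half _ uL' szL' => h1 h2.
have : avg l (fun N => (near l H eps L N)%:R) + avg l (fun N => (near l H eps L' N)%:R)
  <= 1 + avg l (fun P => (near l H eps L P && near l H eps P L')%:R) :> R.
  rewrite -[X in _ <= X + _](avg_const V0 l) -!avgD; apply: ler_avg => // P szP.
  rewrite (nearC _ _ _ _ szP szL') // -!natrD (_ : 1 = 1%:R) // -natrD ler_nat.
  by case: (near l H eps L P); case: (near _ _ _ _ _).
lra.
Qed.

(** * Exchanging two vertices *)

Lemma div_le_large (R : realType) (C xi : R) : 0 < xi ->
  exists n0 : nat, forall n : nat, (n0 <= n)%N -> C / n%:R <= xi.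
Proof.
move=> xi0; exists (Num.bound (`|C| / xi)).+1 => n n0.
have nR : 0 < n%:R :> R by rewrite ltr0n; apply: leq_trans n0.
rewrite ler_pdivrMr //; apply: (le_trans (ler_norm C)).
rewrite mulrC -ler_pdivrMr //; apply: ltW.
have := archi_boundP (divr_ge0 (normr_ge0 C) (ltW xi0)).
by move=> /lt_le_trans; apply; rewrite ler_nat ltnW.
Qed.

Section FourCycles.

Variables (R : realType) (V : finType).
Hypothesis V_gt0 : (0 < #|V|)%N.

(** Counting of 4-cycles by Cauchy-Schwarz, once for degrees and once for codegrees. The factor of
    the edge [x y] is kept apart so that the rest counts the paths of three edges closing it to a
    4-cycle. *)
Lemma c4_density (g : seq V -> seq V -> R) : (forall x y, g x y = g y x) ->
  avg 1 (fun x => avg 1 (g x)) ^+ 4 <=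
  avg 1 (fun x => avg 1 (fun y => g x y *
    avg 1 (fun z => avg 1 (fun w => g y z * g z w * g w x)))).
Proof.
move=> gC; pose d x z := avg 1 (fun y => g x y * g y z).
have dC x z : d x z = d z x.
  by apply: eq_avg => y _; rewrite mulrC gC [g x y]gC.
have -> : avg 1 (fun x => avg 1 (fun y => g x y *
    avg 1 (fun z => avg 1 (fun w => g y z * g z w * g w x)))) =
    avg 1 (fun x => avg 1 (fun z => d x z ^+ 2)).
  apply: eq_avg => x _; under eq_avg => y _ do rewrite -avgZ.
  rewrite avg_swap //; apply: eq_avg => z _.
  rewrite expr2 {2}dC -avgZr; apply: eq_avg => y _.
  rewrite -!avgZ; apply: eq_avg => w _; ring.
apply: (@le_trans _ _ (avg 1 (fun x => avg 1 (d x)) ^+ 2)); last first.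
  apply: le_trans (avg_CS V_gt0 _ _) _; apply: ler_avg => // x _; exact: avg_CS.
have -> : avg 1 (fun x => avg 1 (d x)) = avg 1 (fun y => avg 1 (g y) ^+ 2).
  under eq_avg => x _ do rewrite avg_swap //.
  rewrite avg_swap //; apply: eq_avg => y _; rewrite expr2 -avgZr.
  by apply: eq_avg => x _; rewrite avgZ gC.
rewrite (exprM _ 2 2) lerXn2r ?nnegrE ?sqr_ge0 //; last exact: avg_CS.
by apply: avg_ge0 => // x _; apply: sqr_ge0.
Qed.

End FourCycles.

(** * Exchange gadgets from 4-cycles in links *)

Section Exchange.

Variables (R : realType) (k l : nat) (V : finType) (H : kgraph k V).
Hypothesis V_gt0 : (0 < #|V|)%N.
Hypothesis l2_lt_k : (2 * l < k)%N.
Hypothesis l_gt0 : (0 < l)%N.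

(** The inner vertices matter only as a multiset; their order along the walk is free. *)
Definition joins (q : nat) (A B U : seq V) : Prop :=
  exists2 s, perm_eq s U & walk l H q (A ++ s ++ B).

(** The gadget [g] together with either of [x] and [y] forms a walk with two edges between the same
    ends. *)
Definition exchanges (x y g : seq V) : Prop :=
  exists A B s, [/\ size A = l, size B = l, perm_eq g (A ++ s ++ B),
    joins 2 A B (x ++ s) & joins 2 A B (y ++ s)].

(* The first edge contains both z and w; only the order of its vertices
   decides which of them is passed on to the second edge. *)
Lemma exchanges_intro (x y J z w S S' : seq V) :
  size x = 1%N -> size y = 1%N -> size z = 1%N -> size w = 1%N ->
  size J = l.-1 -> size S = (k - l.+1)%N -> size S' = (k - l.+1)%N ->
  spans_edge H (y ++ z ++ J ++ S) -> spans_edge H (w ++ x ++ J ++ S) ->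
  spans_edge H (z ++ w ++ J ++ S') ->
  exchanges x y (J ++ z ++ w ++ S ++ S').
Proof.
move=> szx szy szz szw szJ szS szS' yz wx zw.
pose M2 := take (k - 2 * l - 1) S; pose L2 := drop (k - 2 * l - 1) S.
pose L0 := take l S'; pose M1 := drop l S'.
have SE : S = M2 ++ L2 by rewrite cat_take_drop.
have SE' : S' = L0 ++ M1 by rewrite cat_take_drop.
have szM2 : size M2 = (k - 2 * l - 1)%N by rewrite size_takel // szS; lia.
have szL2 : size L2 = l by rewrite size_drop szS; lia.
have szL0 : size L0 = l by rewrite size_takel // szS'; lia.
have szM1 : size M1 = (k - 2 * l - 1)%N by rewrite size_drop szS'; lia.
clearbody M2 L2 L0 M1; subst S S'.
(* The general shape of both walks: the edges meet in [J ++ a], [b] is private to the first edge and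
   [c] to the second. It is used with (a, b, c) equal to (w, z, x) and to (z, w, y). *)
have two (a b c : seq V) : size a = 1%N -> size b = 1%N -> size c = 1%N ->
    spans_edge H (a ++ b ++ J ++ L0 ++ M1) -> spans_edge H (a ++ c ++ J ++ M2 ++ L2) ->
    walk l H 2 (L0 ++ (M1 ++ b ++ J ++ a ++ M2 ++ c) ++ L2).
  move=> sza szb szc ab ac.
  have -> : L0 ++ (M1 ++ b ++ J ++ a ++ M2 ++ c) ++ L2 =
    (L0 ++ M1 ++ b) ++ (J ++ a) ++ (M2 ++ c ++ L2) by rewrite -!catA.
  apply: (walk_cat l2_lt_k (q1 := 1) (q2 := 1)).
  - by rewrite size_cat szJ sza addn1 prednK.
  - rewrite walk1 //; apply/andP; split.
      by rewrite !size_cat szL0 szM1 szb szJ sza; apply/eqP; lia.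
    rewrite (@eq_spans_edge k V H _ (a ++ b ++ J ++ L0 ++ M1)) // => u.
    by rewrite !mem_cat; do !case: (u \in _).
  rewrite walk1 //; apply/andP; split.
    by rewrite !size_cat szL2 szM2 szc szJ sza; apply/eqP; lia.
  rewrite (@eq_spans_edge k V H _ (a ++ c ++ J ++ M2 ++ L2)) // => u.
  by rewrite !mem_cat; do !case: (u \in _).
exists L0, L2, (M1 ++ w ++ J ++ z ++ M2); split=> //.
- apply/permP => a; rewrite !count_cat; lia.
- exists (M1 ++ z ++ J ++ w ++ M2 ++ x); first by apply/permP => a; rewrite !count_cat; lia.
  apply: two => //; rewrite (@eq_spans_edge k V H _ (z ++ w ++ J ++ L0 ++ M1)) // => u.
  by rewrite !mem_cat; do !case: (u \in _).
exists (M1 ++ w ++ J ++ z ++ M2 ++ y); first by apply/permP => a; rewrite !count_cat; lia.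
apply: two => //; rewrite (@eq_spans_edge k V H _ (y ++ z ++ J ++ M2 ++ L2)) // => u.
by rewrite !mem_cat; do !case: (u \in _).
Qed.

(** Two edges of a walk cover [2 * k - l] vertices, one of which is the exchanged one. *)
Definition exchange_density (x y : seq V) : R :=
  avg (2 * k - l - 1) (fun g => `[< exchanges x y g >]%:R).

Let edge (T x y : seq V) : R := (spans_edge H (x ++ y ++ T))%:R.

Let edgeC T x y : edge T x y = edge T y x.
Proof.
congr ((nat_of_bool _)%:R); apply: eq_spans_edge => u.
by rewrite !mem_cat orbCA.
Qed.

Let edge_ge0 T x y : 0 <= edge T x y. Proof. by rewrite ler0n. Qed.

Let paths3 (T x y : seq V) : R :=
  avg 1 (fun z => avg 1 (fun w => edge T y z * edge T z w * edge T w x)).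

Let paths3C T x y : paths3 T x y = paths3 T y x.
Proof.
rewrite /paths3 avg_swap //; apply: eq_avg => z _; apply: eq_avg => w _.
rewrite [edge T y _]edgeC [edge T w z]edgeC [edge T _ x]edgeC; ring.
Qed.

Let paths3_ge0 T x y : 0 <= paths3 T x y.
Proof. by do 2![apply: avg_ge0 => // ? _]; rewrite !mulr_ge0. Qed.

(** Marks the edges [x y] of the link of [T] that lie in few 4-cycles of this link. *)
Let rare (delta : R) (T x y : seq V) : R :=
  (spans_edge H (x ++ y ++ T) && (paths3 T x y < delta)%R)%:R.

(** The rare edges form a graph of their own. If its density is p, it has 4-cycle density at least
    p^4 by [c4_density], while each rare edge is closed by fewer than [delta ^+ 4] paths, even in
    the whole link. *)
Lemma avg_rare (delta : R) T : 0 <= delta ->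
  avg 1 (fun x => avg 1 (rare (delta ^+ 4) T x)) <= delta.
Proof.
move=> d0.
have rC x y : rare (delta ^+ 4) T x y = rare (delta ^+ 4) T y x.
  rewrite /rare paths3C (@eq_spans_edge k V H _ (y ++ x ++ T)) // => u.
  by rewrite !mem_cat orbCA.
have le_edge x y : rare (delta ^+ 4) T x y <= edge T x y.
  by rewrite /rare /edge ler_nat; case: (spans_edge _ _) => //=; case: (_ < _)%R.
have r0 x y : 0 <= rare (delta ^+ 4) T x y by rewrite ler0n.
rewrite -(ler_pXn2r (ltn0Sn 3)) ?nnegrE //; last first.
  by do 2![apply: avg_ge0 => // ? _].
apply: (le_trans (c4_density V_gt0 rC)).
rewrite -[leRHS](avg_const V_gt0 1); apply: ler_avg => // x _.
rewrite -[leRHS](avg_const V_gt0 1); apply: ler_avg => // y _.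
apply: (@le_trans _ _ (rare (delta ^+ 4) T x y * paths3 T x y)).
  apply: ler_wpM2l => //; do 2![apply: ler_avg => // ? _].
  by apply: ler_pM; rewrite ?mulr_ge0 //; apply: ler_pM.
rewrite {1}/rare; case: (spans_edge _ _); last by rewrite mul0r exprn_ge0.
by case: ltP => [/ltW|]; rewrite /= ?mul1r // mul0r exprn_ge0.
Qed.

(** At least [c] of the [T] make [x y] an edge of their link, and for less than [c / 2] of all [T]
    this edge is rare; the others provide paths y z w x in the link of [T]. *)
Lemma exchange_density_ge (delta c : R) x y : 0 < delta -> 0 < c ->
  size x = 1%N -> size y = 1%N -> uniq (x ++ y) -> min_avg_degree H 2 c ->
  avg (k - 2) (fun T => rare delta T x y) < c / 2 ->
  (delta * (c / 2)) ^+ 2 <= exchange_density x y.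
Proof.
move=> d0 c0 szx szy uxy md2 few.
have le_paths : delta * (c / 2) <= avg (k - 2) (fun T => paths3 T x y).
  have := md2 _ uxy; rewrite size_cat szx szy => /(_ erefl) le_c.
  have : avg (k - 2) (fun T => edge T x y) <=
      avg (k - 2) (fun T => rare delta T x y) + delta^-1 * avg (k - 2) (fun T => paths3 T x y).
    rewrite -avgZ -avgD; apply: ler_avg => // T _; rewrite /edge /rare.
    case: (spans_edge _ _); last by rewrite add0r mulr_ge0 ?invr_ge0 // ltW.
    case: ltP => [_|le_d] /=; first by rewrite lerDl mulr_ge0 ?invr_ge0 // ltW.
    by rewrite add0r ler_pdivlMl // mulr1.
  have eE : avg (k - 2) (fun T => edge T x y) =
    avg (k - 2) (fun s => (spans_edge H ((x ++ y) ++ s))%:R).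
    by apply: eq_avg => T _; rewrite /edge catA.
  rewrite eE => h; rewrite -ler_pdivlMl //; lra.
pose phi J z w S := edge (J ++ S) y z * edge (J ++ S) z w * edge (J ++ S) w x.
have phi0 J z w S : 0 <= phi J z w S by rewrite !mulr_ge0.
have pathsE : avg (k - 2) (fun T => paths3 T x y) =
    avg l.-1 (fun J => avg 1 (fun z => avg 1 (fun w => avg (k - l.+1) (phi J z w)))).
  rewrite (_ : k - 2 = l.-1 + (k - l.+1))%N; last lia.
  rewrite avg_cat; apply: eq_avg => J _.
  rewrite /paths3 [LHS]avg_swap //; apply: eq_avg => z _.
  by rewrite [LHS]avg_swap.
apply: (@le_trans _ _ (avg (k - 2) (fun T => paths3 T x y) ^+ 2)).
  rewrite lerXn2r ?nnegrE //; first by rewrite mulr_ge0 ?divr_ge0 // ltW.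
  exact: avg_ge0.
rewrite pathsE /exchange_density.
rewrite (_ : 2 * k - l - 1 = l.-1 + (1 + (1 + ((k - l.+1) + (k - l.+1)))))%N; last lia.
(* [T] is split as [J ++ S]. Cauchy-Schwarz keeps [J], [z], [w] and doubles [S] into independent
   copies [S] and [S']: the edges with y z and w x are taken at [S], the one with z w at [S']. *)
rewrite avg_cat; apply: le_trans (avg_CS V_gt0 _ _) _; apply: ler_avg => // J szJ.
rewrite avg_cat; apply: le_trans (avg_CS V_gt0 _ _) _; apply: ler_avg => // z szz.
rewrite avg_cat; apply: le_trans (avg_CS V_gt0 _ _) _; apply: ler_avg => // w szw.
rewrite avg_cat expr2 -avgZr; apply: ler_avg => // S szS.
rewrite -avgZ; apply: ler_avg => // S' szS'; rewrite /phi /edge -!natrM ler_nat !mulnb.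
case yz: (spans_edge H (y ++ _)) => //; case zw: (spans_edge H (z ++ w ++ J ++ S)) => //=.
case wx: (spans_edge H (w ++ _)) => //; case yz': (spans_edge H (y ++ _)) => //.
case zw': (spans_edge H (z ++ _)) => //=.
case: (spans_edge H (w ++ _)) => //=.
by case: asboolP => // -[]; apply: exchanges_intro.
Qed.

End Exchange.

(** Half of [xi] pays for coinciding vertices. The other half pays, by Markov's inequality, for
    pairs that are rare for at least [c / 2] of the [T]; [d0] is chosen to make this exact. *)
Lemma most_pairs_exchange (R : realType) (k l : nat) (c xi : R) :
  (0 < l)%N -> (2 * l < k)%N -> 0 < c -> 0 < xi ->
  exists2 d : R, 0 < d & exists n0 : nat,
    forall (V : finType) (H : kgraph k V), (0 < #|V|)%N -> (n0 <= #|V|)%N ->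
      min_avg_degree H 2 c ->
      avg 1 (fun x => avg 1 (fun y => (exchange_density R l H x y < d)%R%:R)) <= xi.
Proof.
move=> l0 lk c0 xi0; pose d0 := xi / 2 * (c / 2).
have d00 : 0 < d0 by rewrite mulr_gt0 // divr_gt0.
exists ((d0 ^+ 4 * (c / 2)) ^+ 2).
  by rewrite exprn_gt0 // mulr_gt0 ?exprn_gt0 // divr_gt0.
have [n0 le_n0] := div_le_large (2 * 2)%:R (divr_gt0 xi0 (ltr0n R 2)).
exists n0 => V H V0 nV md2.
pose rr (x y : seq V) : R := avg (k - 2) (fun T : seq V =>
  (spans_edge H (x ++ y ++ T) && (avg 1 (fun z => avg 1 (fun w =>
   (spans_edge H (y ++ z ++ T))%:R * (spans_edge H (z ++ w ++ T))%:R
     * (spans_edge H (w ++ x ++ T))%:R)) < d0 ^+ 4)%R)%:R).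
have rr0 x y : 0 <= rr x y by apply: avg_ge0 => // s _; rewrite ler0n.
apply: (@le_trans _ _ (avg 1 (fun x => avg 1 (fun y =>
    (~~ uniq (x ++ y))%:R + (c / 2)^-1 * rr x y)))).
  apply: ler_avg => // x szx; apply: ler_avg => // y szy.
  have rc0 : 0 <= (c / 2)^-1 * rr x y by rewrite mulr_ge0 // invr_ge0 divr_ge0 // ltW.
  have [uxy|_] := boolP (uniq (x ++ y)); last by rewrite ler_wpDr // lern1 leq_b1.
  rewrite add0r; have [lt_c|le_c] := ltP (rr x y) (c / 2); last first.
    by apply: (@le_trans _ _ 1); rewrite ?lern1 ?leq_b1 // ler_pdivlMl ?mulr1 // divr_gt0.
  rewrite ltNge (exchange_density_ge V0 lk l0 _ c0 szx szy uxy md2) //.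
  by rewrite exprn_gt0.
under eq_avg => x _ do rewrite avgD avgZ.
rewrite avgD avgZ.
have -> : xi = xi / 2 + (c / 2)^-1 * d0.
  by rewrite /d0; field; rewrite gt_eqF.
apply: lerD.
  have := avg_nuniq_le R V0 (1 + 1)%N; rewrite avg_cat => /le_trans; apply.
  exact: le_n0.
rewrite ler_pM2l ?invr_gt0 ?divr_gt0 //.
under eq_avg => x _ do rewrite avg_swap //.
rewrite avg_swap // -[leRHS](avg_const V0 (k - 2)); apply: ler_avg => // T _.
by apply: avg_rare => //; apply: ltW.
Qed.

(** * Absorbers *)

Section Absorbers.

Variables (R : realType) (k l : nat) (V : finType) (H : kgraph k V).
Hypothesis V_gt0 : (0 < #|V|)%N.
Hypothesis l2_lt_k : (2 * l < k)%N.
Hypothesis l_gt0 : (0 < l)%N.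

Lemma joins_perm q A B U U' : perm_eq U U' -> joins l H q A B U -> joins l H q A B U'.
Proof. by move=> UU' [s sU w]; exists s => //; apply: perm_trans sU UU'. Qed.

Lemma joins_cat q1 q2 A B C U1 U2 : size B = l ->
  joins l H q1 A B U1 -> joins l H q2 B C U2 -> joins l H (q1 + q2) A C (U1 ++ B ++ U2).
Proof.
move=> szB [s1 sU1 w1] [s2 sU2 w2]; exists (s1 ++ B ++ s2).
  by rewrite perm_cat // perm_cat2l.
have -> : A ++ (s1 ++ B ++ s2) ++ C = (A ++ s1) ++ B ++ (s2 ++ C) by rewrite -!catA.
by apply: walk_cat => //; rewrite -catA.
Qed.

Lemma avg_joins_ge q c A B : connected_by l H q c -> uniq A -> uniq B ->
  size A = l -> size B = l ->
  c <= avg (R := R) (q * (k - l) - l) (fun U => `[< joins l H q A B U >]%:R).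
Proof.
move=> cq uA uB szA szB; apply: (le_trans (cq A B uA uB szA szB)).
apply: ler_avg => // s _; rewrite ler_nat; case w: (walk _ _ _ _) => //.
by case: asboolP => // -[]; exists s.
Qed.

(** Each vertex [x] of [X] costs five edges: four that connect to the start of a random edge
    containing [x], and this edge itself, with [x] between its ends. Four more edges lead to [B]. *)
Lemma avg_joins_through (c1 c4 : R) (X A B : seq V) : 0 <= c1 -> 0 <= c4 ->
  connected_by l H 4 c4 -> min_avg_degree H 1 c1 ->
  uniq A -> uniq B -> size A = l -> size B = l ->
  c4 * (c1 * c4) ^+ size X <=
  avg ((5 * size X + 4) * (k - l) - l - size X)
    (fun U => `[< joins l H (5 * size X + 4) A B (X ++ U) >]%:R).
Proof.
move=> c10 c40 cc4 md1 uA uB szA szB; elim: X A uA szA => [|x X IH] A uA szA.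
  by rewrite expr0 mulr1 muln0 add0n subn0; apply: avg_joins_ge.
have -> : c4 * (c1 * c4) ^+ size (x :: X) = c1 * (c4 * (c4 * (c1 * c4) ^+ size X)).
  by rewrite exprS; ring.
set n := size X; have -> : size (x :: X) = n.+1 by [].
have -> : ((5 * n.+1 + 4) * (k - l) - l - n.+1 =
    (k - 1) + ((4 * (k - l) - l) + ((5 * n + 4) * (k - l) - l - n)))%N.
  have h1 : (5 * n.+1 + 4 = 5 * n + 4 + 4 + 1)%N by lia.
  have h2 : (l + n <= (5 * n + 4) * (k - l))%N.
    apply: (@leq_trans ((n + 1) * (k - l))); last by rewrite leq_mul2r; lia.
    by rewrite mulnDl mul1n addnC leq_add ?leq_pmulr; lia.
  by rewrite h1 2!mulnDl mul1n; move: h2 l2_lt_k; clear; lia.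
have c0 : 0 <= c4 * (c1 * c4) ^+ n by rewrite mulr_ge0 // exprn_ge0 // mulr_ge0.
apply: (avg_bind V_gt0 (P := fun s => spans_edge H (x :: s))
  (Q := fun s t => `[< joins l H (5 * n.+1 + 4) A B ((x :: X) ++ (s ++ t)) >])) => //.
- by rewrite mulr_ge0.
- exact: (md1 [:: x]).
move=> s szs xs.
pose L := take l s; pose M := take (k - 2 * l - 1) (drop l s).
pose L' := drop (k - 2 * l - 1) (drop l s).
have sE : s = L ++ M ++ L' by rewrite !cat_take_drop.
have szL : size L = l by rewrite size_takel // szs; lia.
have szM : size M = (k - 2 * l - 1)%N by rewrite size_takel // size_drop szs; lia.
have szL' : size L' = l by rewrite !size_drop szs; lia.
clearbody L M L'; subst s.
have w1 : walk l H 1 (L ++ (M ++ [:: x]) ++ L').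
  rewrite walk1 // (@eq_spans_edge k V H _ (x :: L ++ M ++ L')) ?xs ?andbT.
    by rewrite !size_cat szL szM szL' /=; apply/eqP; lia.
  by move=> u; rewrite !(mem_cat, inE); do !case: (u \in _); rewrite ?orbT ?orbF.
have uL := walk_uniq_first l2_lt_k szL w1.
have uL' : uniq L' by move: w1; rewrite catA => w1; apply: walk_uniq_last w1.
apply: (avg_bind V_gt0 (P := fun t => walk l H 4 (A ++ t ++ L))
  (Q := fun _ t => `[< joins l H (5 * n + 4) L' B (X ++ t) >])) => //.
- exact: cc4.
- by move=> t szt w4; apply: IH.
move=> t u szt szu w4 /asboolP j; apply/asboolP.
have j4 : joins l H 4 A L t by exists t.
have j1 : joins l H 1 L L' (M ++ [:: x]) by exists (M ++ [:: x]).
rewrite (_ : 5 * n.+1 + 4 = 4 + (1 + (5 * n + 4)))%N; last by clear; lia.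
apply: joins_perm (joins_cat szL j4 (joins_cat szL' j1 j)).
by apply/permP => a; rewrite /= !count_cat /=; clear; lia.
Qed.

Lemma last_end_cat (a b : seq V) : (l <= size b)%N -> last_end l (a ++ b) = last_end l b.
Proof. by move=> lb; rewrite /last_end size_cat -addnBA // drop_cat ltnNge leq_addr /= addKn. Qed.

(** Both walks start with [A] and have the same last end, but one uses [Y] and the other [Y']. *)
Definition switches (q : nat) (A Y Y' : seq V) : Prop :=
  exists s s', [/\ perm_eq s Y, perm_eq s' Y', walk l H q (A ++ s), walk l H q (A ++ s')
    & last_end l (A ++ s) = last_end l (A ++ s')].

(** For each pair of corresponding entries of [U] and [U'], four connecting edges are followed by an
    exchange gadget of two edges. The vertices of connections and gadgets make up [W] and are used
    in both walks. *)
Lemma avg_switches_ge (d c4 : R) (U U' A : seq V) : 0 <= d -> 0 <= c4 ->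
  connected_by l H 4 c4 ->
  all2 (fun x y => d <= exchange_density R l H [:: x] [:: y])%R U U' ->
  uniq A -> size A = l ->
  (d * c4) ^+ size U <=
  avg (size U * ((2 * k - l - 1) + (4 * (k - l) - l)))
    (fun W => `[< switches (6 * size U) A (U ++ W) (U' ++ W) >]%:R).
Proof.
move=> d0 c40 cc4; elim: U U' A => [|u U IH] [|u' U'] A //=.
  move=> _ uA szA; rewrite expr0 mul0n avg0 ler1n lt0b; apply/asboolP.
  by exists [::], [::]; rewrite cats0 walk0 szA eqxx.
case/andP => du dU uA szA; rewrite exprS -mulrA mulSn -addnA.
have c0 : 0 <= (d * c4) ^+ size U by rewrite exprn_ge0 // mulr_ge0.
apply: (avg_bind V_gt0 (P := fun g => `[< exchanges l H [:: u] [:: u'] g >])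
  (Q := fun g t => `[< switches (6 * (size U).+1) A (u :: U ++ (g ++ t)) (u' :: U' ++ (g ++ t)) >])) => //.
  by rewrite mulr_ge0.
move=> g szg /asboolP[A' [B' [s [szA' szB' gE [s1 s1E w1] [s1' s1E' w1']]]]].
have uA' := walk_uniq_first l2_lt_k szA' w1.
have uB' : uniq B' by move: w1; rewrite catA => w1; apply: walk_uniq_last w1.
apply: (avg_bind V_gt0 (P := fun t => walk l H 4 (A ++ t ++ A'))
  (Q := fun _ t => `[< switches (6 * size U) B' (U ++ t) (U' ++ t) >])) => //.
- exact: cc4.
- by move=> t szt w4; apply: IH.
move=> t v szt szv w4 /asboolP[w [w' [wE wE' ww ww' we]]]; apply/asboolP.
exists (t ++ A' ++ s1 ++ B' ++ w), (t ++ A' ++ s1' ++ B' ++ w'); split.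
- apply/permP => a; move/permP/(_ a): wE; move/permP/(_ a): s1E; move/permP/(_ a): gE.
  by rewrite /= !count_cat /=; clear; lia.
- apply/permP => a; move/permP/(_ a): wE'; move/permP/(_ a): s1E'; move/permP/(_ a): gE.
  by rewrite /= !count_cat /=; clear; lia.
- have -> : (6 * (size U).+1 = 4 + (2 + 6 * size U))%N by rewrite mulnS addnA.
  rewrite [A ++ _]catA; apply: (walk_cat l2_lt_k szA'); rewrite -?catA //.
  by rewrite [A' ++ _]catA; apply: (walk_cat l2_lt_k szB'); rewrite -?catA.
- have -> : (6 * (size U).+1 = 4 + (2 + 6 * size U))%N by rewrite mulnS addnA.
  rewrite [A ++ _]catA; apply: (walk_cat l2_lt_k szA'); rewrite -?catA //.
  by rewrite [A' ++ _]catA; apply: (walk_cat l2_lt_k szB'); rewrite -?catA.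
have le z z' : last_end l (A ++ t ++ A' ++ z ++ B' ++ z') = last_end l (B' ++ z').
  have -> : A ++ t ++ A' ++ z ++ B' ++ z' = (A ++ t ++ A' ++ z) ++ (B' ++ z').
    by rewrite -!catA.
  by rewrite last_end_cat // size_cat szB' leq_addr.
by rewrite !le.
Qed.

Lemma avg_all2_le (E : seq V -> seq V -> bool) r :
  avg r (fun U => avg r (fun U' =>
    (~~ all2 (fun x y => E [:: x] [:: y]) U U')%:R : R)) <=
  r%:R * avg 1 (fun x => avg 1 (fun y => (~~ E x y)%:R)).
Proof.
elim: r => [|r IH]; first by rewrite !avg0 mul0r.
set e := avg 1 _; rewrite -natr1 mulrDl mul1r.
rewrite avg_cons; under eq_avg => x _ do under eq_avg => U _ do rewrite avg_cons.
apply: (@le_trans _ _ (avg 1 (fun x => avg r (fun U => avg 1 (fun y => avg r (fun U' =>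
   (~~ all2 (fun x y => E [:: x] [:: y]) U U')%:R + (~~ E x y)%:R)))))).
  apply: ler_avg => // -[//|x [|//]] _; apply: ler_avg => // U _.
  apply: ler_avg => // -[//|y [|//]] _; apply: ler_avg => // U' _.
  by rewrite -natrD ler_nat /=; case: (E _ _); case: (all2 _ _ _).
under eq_avg => x _ do under eq_avg => U _ do under eq_avg => y _ do rewrite avgD avg_const //.
under eq_avg => x _ do under eq_avg => U _ do rewrite avgD avg_const //.
under eq_avg => x _ do rewrite avgD avg_const //.
by rewrite avgD avg_const // lerD.
Qed.

Definition absorber (q : nat) (X p : seq V) : Prop :=
  walk l H q p /\ exists p', [/\ walk l H q.+1 p', perm_eq p' (p ++ X),
    take l p' = take l p & last_end l p' = last_end l p].

(* A random t yields, for each X, a rearrangement absorbing X that may depend on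
   X; passing to random rearrangements removes this dependence. *)
Lemma avg_perm_le (A : pred (seq V)) b :
  avg (R := R) b (fun t => `[< exists2 p, perm_eq p t & A p >]%:R) <=
  b`!%:R * avg b (fun p => (A p)%:R).
Proof.
rewrite !avg_tuple mulrA ler_pM2r ?invr_gt0 ?exprn_gt0 ?ltr0n //.
pose act (s : 'S_b) (t : b.-tuple V) := [tuple tnth t (s i) | i < b].
apply: (@le_trans _ _ (\sum_(t : b.-tuple V) \sum_(s : 'S_b) (A (act s t))%:R)).
  apply: ler_sum => t _; case: asboolP => [[p pt Ap]|_]; last by rewrite sumr_ge0.
  have /tuple_permP[s sE] := pt.
  by rewrite (bigD1 s) //= -sE Ap ler_wpDr // sumr_ge0.
rewrite exchange_big /= (eq_bigr (fun=> \sum_(t : b.-tuple V) (A t)%:R)) => [|s _].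
  by rewrite sumr_const card_Sn -[leLHS]mulr_natl.
rewrite [RHS](reindex (act s)) //=; exists (act s^-1%g) => t _;
  apply: eq_from_tnth => i; rewrite !tnth_mktuple.
- by rewrite permKV.
- by rewrite permK.
Qed.

(** A walk from [A] to [B] with [q] edges has [r] inner vertices [U']; one with [q + 1] edges
    through [X] has, besides the [k - l] vertices of [X], also exactly [r], called [U]. Pairs that
    cannot be exchanged spoil at most half of the density [g] of pairs of such walks. *)
Lemma avg_absorber_ge (c1 c4 cq d : R) (X : seq V) :
  let q := (5 * (k - l) + 3)%N in let r := (q * (k - l) - l)%N in
  let g := cq * (c4 * (c1 * c4) ^+ (k - l)) in
  0 <= c1 -> 0 <= c4 -> 0 <= cq -> 0 <= d ->
  connected_by l H 4 c4 -> connected_by l H q cq -> min_avg_degree H 1 c1 ->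
  avg 1 (fun x => avg 1 (fun y => (exchange_density R l H x y < d)%R%:R)) <= g / (2 * r%:R) ->
  ((l + l) * (l + l))%:R / #|V|%:R <= 1 / 2 :> R ->
  size X = (k - l)%N ->
  1 / 2 * (g / 2 * (d * c4) ^+ r) <=
  avg ((l + l) + ((r + r) + r * ((2 * k - l - 1) + (4 * (k - l) - l))))
    (fun t => `[< exists2 p, perm_eq p t & `[< absorber (q + 6 * r) X p >] >]%:R).
Proof.
move=> q r g c10 c40 cq0 d0 cc4 ccq md1 few large szX.
have cX0 : 0 <= c4 * (c1 * c4) ^+ (k - l) by rewrite mulr_ge0 // exprn_ge0 // mulr_ge0.
have g0 : 0 <= g by rewrite mulr_ge0.
have r0 : (0 < r)%N.
  rewrite /r /q subn_gt0; apply: (@leq_trans (k - l)); first lia.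
  by rewrite leq_pmull // addnS.
have dc0 : 0 <= (d * c4) ^+ r by rewrite exprn_ge0 // mulr_ge0.
apply: (avg_bind V_gt0 (P := @uniq V)
  (Q := fun e t =>
    `[< exists2 p, perm_eq p (e ++ t) & `[< absorber (q + 6 * r) X p >] >])) => //.
- by rewrite mulr_ge0 // divr_ge0.
- apply: le_trans (avg_uniq_ge R V_gt0 (l + l)); lra.
move=> e sze; rewrite -[e](cat_take_drop l); set A := take l e; set B := drop l e.
have szA : size A = l by rewrite size_takel // sze leq_addr.
have szB : size B = l by rewrite size_drop sze addnK.
rewrite cat_uniq => /and3P[uA _ uB].
pose good (U U' : seq V) :=
  all2 (fun x y => d <= exchange_density R l H [:: x] [:: y])%R U U'.
pose J U := `[< joins l H q A B U >].
pose J' U := `[< joins l H q.+1 A B (X ++ U) >].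
apply: (avg_bind V_gt0 (P := fun UU => [&& J (drop r UU), J' (take r UU) & good (take r UU) (drop r UU)])
  (Q := fun UU W => `[< switches (6 * r) B (take r UU ++ W) (drop r UU ++ W) >])) => //.
- rewrite avg_cat.
  have leJ : cq <= avg r (fun U => (J U)%:R) by apply: avg_joins_ge.
  have leJ' : c4 * (c1 * c4) ^+ (k - l) <= avg r (fun U => (J' U)%:R).
    have := avg_joins_through X c10 c40 cc4 md1 uA uB szA szB.
    rewrite szX (_ : 5 * (k - l) + 4 = q.+1)%N; last by rewrite /q addnS.
    by rewrite (_ : q.+1 * (k - l) - l - (k - l) = r)%N // /r mulSn; move: (q * _)%N l2_lt_k => z; clear; lia.
  have le_prod : g <= avg r (fun U => avg r (fun U' => (J' U)%:R * (J U')%:R)).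
    under eq_avg => U _ do rewrite avgZ.
    by rewrite avgZr mulrC ler_pM.
  have := avg_all2_le (fun x y => d <= exchange_density R l H x y)%R r.
  under [in leRHS]eq_avg => x _ do under eq_avg => y _ do rewrite -ltNge.
  move=> bad; have {}bad : avg r (fun U => avg r (fun U' => (~~ good U U')%:R)) <= g / 2.
    apply: (le_trans bad); apply: (le_trans (ler_wpM2l (ler0n _ r) few)).
    by rewrite le_eqVlt; apply/orP; left; apply/eqP; field; rewrite pnatr_eq0 -lt0n.
  suff : avg r (fun U => avg r (fun U' => (J' U)%:R * (J U')%:R)) <=
      avg r (fun s => avg r (fun t => [&& J (drop r (s ++ t)), J' (take r (s ++ t)) &
        good (take r (s ++ t)) (drop r (s ++ t))]%:R)) +
      avg r (fun U => avg r (fun U' => (~~ good U U')%:R)) :> R by lra.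
  rewrite -avgD; apply: ler_avg => // U szU; rewrite -avgD; apply: ler_avg => // U' szU'.
  rewrite take_size_cat // drop_size_cat // -natrM -natrD ler_nat.
  by case: (J' U); case: (J U'); case: (good U U').
- move=> UU szUU /and3P[_ _ gUU].
  have szU : size (take r UU) = r by rewrite size_takel // szUU leq_addr.
  by have := avg_switches_ge d0 c40 cc4 gUU uB szB; rewrite szU.
move=> UU W szUU szW /and3P[/asboolP[s sE w1] /asboolP[s' sE' w2] _].
move=> /asboolP[v [v' [vE vE' w3 w4 ve]]]; apply/asboolP.
(* Without [X], the part from [A] to [B] uses [U'] and the switch after [B] uses [U]; with [X], the
   first part uses [X] and [U], and the switch uses [U']. *)
exists (A ++ s ++ B ++ v).
  apply/permP => a; move/permP/(_ a): vE; move/permP/(_ a): sE.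
  by rewrite -[in count a (_ ++ UU ++ _)](cat_take_drop r UU) !count_cat; clear; lia.
apply/asboolP; split; first by rewrite [A ++ _]catA; apply: walk_cat; rewrite -?catA.
exists (A ++ s' ++ B ++ v'); split.
- by rewrite -addSn [A ++ _]catA; apply: walk_cat; rewrite -?catA.
- apply/permP => a; move/permP/(_ a): vE; move/permP/(_ a): sE.
  by move/permP/(_ a): vE'; move/permP/(_ a): sE'; rewrite !count_cat; clear; lia.
- by rewrite !take_size_cat.
have le z z' : last_end l (A ++ z ++ B ++ z') = last_end l (B ++ z').
  by rewrite [A ++ _]catA last_end_cat // size_cat szB leq_addr.
by rewrite !le ve.
Qed.

End Absorbers.

Lemma connected_by_iter (R : realType) (k l : nat) (V : finType) (H : kgraph k V)
    (d c : R) q j : (0 < #|V|)%N -> (2 * l < k)%N -> 0 <= c -> 0 <= d -> (0 < q)%N ->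
  min_avg_degree H l d -> connected_by l H q c -> connected_by l H (q + j) (d ^+ j * c).
Proof.
move=> V0 lk c0 d0 q0 mdl cq; elim: j => [|j IH]; first by rewrite addn0 expr0 mul1r.
rewrite addnS exprS -mulrA; apply: connected_byS => //.
- by rewrite mulr_ge0 // exprn_ge0.
- by rewrite addn_gt0 q0.
Qed.

Lemma absorbers_abundant (R : realType) (k l : nat) (c1 c2 c4 dl : R) :
  (0 < l)%N -> (2 * l < k)%N -> 0 < c1 -> 0 < c2 -> 0 < c4 -> 0 < dl ->
  exists q b : nat, (0 < q)%N /\ exists2 c : R, 0 < c & exists n0 : nat,
    forall (V : finType) (H : kgraph k V), (0 < #|V|)%N -> (n0 <= #|V|)%N ->
      min_avg_degree H 1 c1 -> min_avg_degree H 2 c2 -> min_avg_degree H l dl ->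
      connected_by l H 4 c4 ->
      forall X, size X = (k - l)%N ->
        c <= avg b (fun p => `[< absorber l H q X p >]%:R).
Proof.
move=> l0 lk c10 c20 c40 dl0.
pose q := (5 * (k - l) + 3)%N; pose r := (q * (k - l) - l)%N.
have r0 : (0 < r)%N.
  rewrite /r /q subn_gt0; apply: (@leq_trans (k - l)); first lia.
  by rewrite leq_pmull // addnS.
(* The connection with four edges is lengthened by 5(k-l) - 1 edges to the required 5(k-l) + 3. *)
pose cq := dl ^+ (5 * (k - l) - 1) * c4.
have cq0 : 0 < cq by rewrite mulr_gt0 // exprn_gt0.
pose g := cq * (c4 * (c1 * c4) ^+ (k - l)).
have g0 : 0 < g by rewrite !mulr_gt0 // exprn_gt0 // mulr_gt0.
have xi0 : 0 < g / (2 * r%:R) by rewrite divr_gt0 // mulr_gt0 // ltr0n.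
have [d d0 [n1 exch]] := most_pairs_exchange l0 lk c20 xi0.
have [n2 large] := div_le_large ((l + l) * (l + l))%:R (divr_gt0 (@ltr01 R) (ltr0n R 2)).
pose b := ((l + l) + ((r + r) + r * ((2 * k - l - 1) + (4 * (k - l) - l))))%N.
exists (q + 6 * r)%N, b; split; first by rewrite addn_gt0 [(0 < q)%N]addn_gt0 orbT.
exists (b`!%:R^-1 * (1 / 2 * (g / 2 * (d * c4) ^+ r))).
  by rewrite mulr_gt0 ?invr_gt0 ?ltr0n ?fact_gt0 // !mulr_gt0 ?invr_gt0 // exprn_gt0 // mulr_gt0.
exists (n1 + n2)%N => V H V0 nV md1 md2 mdl cc4 X szX.
rewrite ler_pdivrMl ?ltr0n ?fact_gt0 //; apply: le_trans (avg_perm_le _ V0 _ _).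
apply: (avg_absorber_ge V0 lk l0 (c1 := c1) (cq := cq)) => //; try exact: ltW.
- rewrite (_ : 5 * (k - l) + 3 = 4 + (5 * (k - l) - 1))%N; last lia.
  by apply: connected_by_iter => //; apply: ltW.
- by apply: exch => //; apply: leq_trans nV; rewrite leq_addr.
- by apply: large; apply: leq_trans nV; rewrite leq_addl.
Qed.

(** * Greedy choice of absorbers *)

Section Assignment.

Variables (T U : eqType) (E : seq U -> pred T).

Let ok (o : seq U) (p : T) := (o == [::]) || E o p.

Lemma assign_block b ps os : all2 ok os ps ->
  (count (predC1 [::]) os < count (E b) ps)%N ->
  exists os', [/\ all2 ok os' ps, perm_eq (flatten os') (b ++ flatten os) &
    (count (predC1 [::]) os' <= (count (predC1 [::]) os).+1)%N].
Proof.
elim: ps os => [|p ps IH] [|o os] //= /andP[op ops].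
case: (boolP ((o == [::]) && E b p)) => [/andP[/eqP-> bp] _|oE lt_c].
  exists (b :: os); rewrite /= /ok bp orbT ops; split=> //.
  by rewrite add0n -[X in (_ <= X)%N]add1n leq_add2r leq_b1.
have [|os' [ok' fl cnt]] := IH os ops.
  by move: oE lt_c; rewrite negb_and; case: eqP => [_|_] /=; case: (E b p) => //=; clear; lia.
exists (o :: os'); rewrite /= op ok'; split=> //; last by rewrite -addnS leq_add2l.
by rewrite perm_sym perm_catCA perm_cat2l perm_sym.
Qed.

(** Greedy choice: whenever a block is to be placed, fewer absorbers are in use than there are
    absorbers suited to it. *)
Lemma assign_blocks bs ps : (forall b, b \in bs -> (size bs <= count (E b) ps)%N) ->
  exists os, [/\ all2 ok os ps, perm_eq (flatten os) (flatten bs) &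
    (count (predC1 [::]) os <= size bs)%N].
Proof.
elim: bs => [_|b bs IH cnt].
  exists (nseq (size ps) [::]); split; first by elim: ps.
  - by elim: (size ps).
  by rewrite count_nseq.
have [|os [ok1 fl c1]] := IH.
  by move=> b' b'bs; apply: ltnW; apply: cnt; rewrite inE b'bs orbT.
have [|os' [ok' fl' c']] := assign_block (b := b) ok1.
  by apply: leq_ltn_trans c1 _; apply: cnt; rewrite mem_head.
exists os'; split=> //; last exact: leq_trans c' _.
by apply: perm_trans fl' _; rewrite perm_cat2l.
Qed.

End Assignment.

(** * Building the path by means of an exponential potential *)

Section Greedy.

Variables (R : realType) (k l : nat) (V : finType) (H : kgraph k V).
Hypothesis V_gt0 : (0 < #|V|)%N.
Hypothesis l2_lt_k : (2 * l < k)%N.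
Hypothesis l_gt0 : (0 < l)%N.
Variables (q b : nat) (c c4 : R).
Hypotheses (c_gt0 : 0 < c) (c_le1 : c <= 1) (c4_gt0 : 0 < c4).
Hypothesis cc4 : connected_by l H 4 c4.

Let abs (X p : seq V) : bool := `[< absorber l H q X p >].

Lemma absorber_perm X X' p : perm_eq X X' -> abs X p = abs X' p.
Proof.
move=> XX'; apply/asboolP/asboolP => -[w [p' [w' pE f e]]]; split=> //; exists p'; split=> //.
  by apply: perm_trans pE _; rewrite perm_cat2l.
by apply: perm_trans pE _; rewrite perm_cat2l perm_sym.
Qed.

Hypothesis many : forall X, size X = (k - l)%N ->
  c <= avg b (fun p => (abs X p)%:R).

Let ok (o p : seq V) := (o == [::]) || abs o p.

(** The absorbers in [ps] can act simultaneously and independently within [P], without changing its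
    ends. *)
Definition absorbs_all (ps : seq (seq V)) (P : seq V) : Prop :=
  forall os, all2 ok os ps ->
    exists q' P', [/\ (0 < q')%N, walk l H q' P', perm_eq P' (P ++ flatten os),
      take l P' = take l P & last_end l P' = last_end l P].

Let conn := (4 * (k - l) - l)%N.

Lemma walk_ends q' P : walk l H q' P ->
  [/\ P = take l P ++ drop l P, size (take l P) = l,
      P = take (size P - l) P ++ last_end l P & size (last_end l P) = l].
Proof.
move=> /size_walk szP; have lP : (l <= size P)%N by rewrite szP leq_addl.
by split; rewrite ?cat_take_drop // ?size_takel // /last_end size_drop subKn.
Qed.

Lemma walk_glue q1 q2 p s P : walk l H q1 p -> walk l H q2 P ->
  walk l H 4 (last_end l p ++ s ++ take l P) -> walk l H (q1 + (4 + q2)) (p ++ s ++ P).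
Proof.
move=> w1 w2 w; have [_ _ pE szp] := walk_ends w1; have [PE szP _ _] := walk_ends w2.
rewrite pE -catA; apply: walk_cat => //; first by rewrite -pE.
rewrite {1}PE catA [_ ++ take l P ++ _]catA -catA [_ ++ take l P ++ _]catA.
rewrite -!catA [last_end l p ++ _]catA; apply: walk_cat; rewrite -?catA -?PE //.
Qed.

Lemma first_glue q1 p (s : seq V) : walk l H q1 p -> take l (p ++ s) = take l p.
Proof. by move=> /size_walk szp; rewrite takel_cat // szp leq_addl. Qed.

Lemma last_glue q1 p (s : seq V) : walk l H q1 p -> last_end l (s ++ p) = last_end l p.
Proof. by move=> /size_walk szp; apply: last_end_cat; rewrite szp leq_addl. Qed.

Lemma absorbs_all_cons q' p s P ps : walk l H q p -> walk l H q' P ->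
  walk l H 4 (last_end l p ++ s ++ take l P) ->
  absorbs_all ps P -> absorbs_all (p :: ps) (p ++ s ++ P).
Proof.
move=> wp wP ws ab [//|o os] /= /andP[op ops].
have [q2 [P' [q20 w' PE' f' e']]] := ab os ops.
have [q1 [p1 [w1 pE1 f1 e1]]] : exists q1 p1, [/\ walk l H q1 p1, perm_eq p1 (p ++ o),
    take l p1 = take l p & last_end l p1 = last_end l p].
  case/orP: op => [/eqP->|/asboolP[_ [p1 [w1 pE f1 e1]]]]; last by exists q.+1, p1.
  by exists q, p; rewrite cats0.
exists (q1 + (4 + q2))%N, (p1 ++ s ++ P'); split.
- by rewrite !addn_gt0 orbT.
- by apply: walk_glue => //; rewrite e1 f'.
- apply/permP => a; move/permP/(_ a): pE1; move/permP/(_ a): PE'.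
  by rewrite !count_cat; clear; lia.
- by rewrite (first_glue _ w1) (first_glue _ wp).
by rewrite !catA (last_glue _ w') (last_glue _ wP).
Qed.

(** Each set of [k - l] vertices has weight 2^(-j), where j is the number of its absorbers in [ps];
    a small total forces every set to have many absorbers. *)
Definition potential (ps : seq (seq V)) : R :=
  \sum_(X : {set V} | #|X| == (k - l)%N) (1 / 2) ^+ count (abs (enum X)) ps.

Lemma potential_ge0 ps : 0 <= potential ps.
Proof. by apply: sumr_ge0 => X _; rewrite exprn_ge0 // divr_ge0. Qed.

Lemma avg_avoid_ge (A : pred (seq V)) m (x : R) (P : seq V) :
  x <= avg m (fun p => (A p)%:R) ->
  x - (m * (m + size P))%:R / #|V|%:R <=
    avg m (fun p => ([&& uniq p, ~~ has (mem P) p & A p])%:R).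
Proof.
move=> le_x; rewrite lerBlDr; apply: (le_trans le_x).
have := avg_nuniq_le R V_gt0 m; have := avg_meets_le R V_gt0 P m => h1 h2.
have h3 : avg m (fun p => (has (mem P) p)%:R) + avg m (fun p : seq V => (~~ uniq p)%:R) <=
    (m * (m + size P))%:R / #|V|%:R :> R.
  by apply: (le_trans (lerD h1 h2)); rewrite -mulrDl mulnDr natrD addrC -natrM.
apply: (@le_trans _ _ (avg m (fun p => ([&& uniq p, ~~ has (mem P) p & A p])%:R) +
  (avg m (fun p => (has (mem P) p)%:R) + avg m (fun p : seq V => (~~ uniq p)%:R)))).
  rewrite -!avgD; apply: ler_avg => // p _; rewrite -!natrD ler_nat.
  by case: (uniq p); case: (has _ p); case: (A p).
by rewrite lerD2l.
Qed.

(** A random [p] is an absorber for a given set, repetition-free and disjoint from [P], with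
    probability at least [c / 2], and then halves the weight of that set. The expected decrease [F]
    is thus at least [c / 4] of the potential, and some [p] attains it; as the decrease is positive,
    this [p] is admissible. *)
Lemma greedy_step ps (P : seq V) : (k - l <= #|V|)%N ->
  (b * (b + size P))%:R / #|V|%:R <= c / 2 ->
  exists p, [/\ size p = b, uniq p, ~~ has (mem P) p, walk l H q p &
    potential (p :: ps) <= (1 - c / 4) * potential ps].
Proof.
move=> kn small.
pose w (X : {set V}) : R := (1 / 2) ^+ count (abs (enum X)) ps.
have w0 X : 0 < w X by rewrite exprn_gt0 // divr_gt0.
pose F p : R := \sum_(X : {set V} | #|X| == (k - l)%N)
  w X / 2 * ([&& uniq p, ~~ has (mem P) p & abs (enum X) p])%:R.
have phi0 : 0 < potential ps.
  have : (0 < #|[set X : {set V} | #|X| == (k - l)%N]|)%N.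
    by rewrite card_draws bin_gt0.
  case/card_gt0P => X; rewrite inE => szX; rewrite /potential (bigD1 X) //=.
  apply: ltr_wpDr; last by rewrite exprn_gt0 // divr_gt0.
  by apply: sumr_ge0 => Y _; rewrite exprn_ge0 // divr_ge0.
have : c / 4 * potential ps <= avg b F.
  rewrite avg_sum // /potential mulr_sumr; apply: ler_sum => X /eqP szX.
  rewrite avgZ -/(w X).
  have -> : c / 4 * w X = w X / 2 * (c / 2) by move: (w X) => z; field.
  rewrite ler_pM2l ?divr_gt0 //.
  have szX' : size (enum X) = (k - l)%N by rewrite -cardE.
  by apply: le_trans (avg_avoid_ge P (many szX')); lra.
move/(avg_exists V_gt0) => [p szp leF].
have F0 : 0 < F p by apply: lt_le_trans leF; rewrite mulr_gt0 // divr_gt0.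
have [X szX /and3P[up dis ap]] : exists2 X : {set V}, #|X| == (k - l)%N &
    [&& uniq p, ~~ has (mem P) p & abs (enum X) p].
  have [[X szX h]|no] := pselect (exists2 X : {set V}, #|X| == (k - l)%N &
    [&& uniq p, ~~ has (mem P) p & abs (enum X) p]); first by exists X.
  move: F0; rewrite /F big1 ?ltxx // => X szX; have [h|_] := boolP [&& _, _ & _]; last by rewrite mulr0.
  by case: no; exists X.
exists p; split=> //; first by case/asboolP: ap.
have -> : potential (p :: ps) = potential ps - F p.
  rewrite /potential /F -sumrB; apply: eq_bigr => Y _; rewrite /= up dis /= -/(w Y).
  by rewrite exprD -/(w Y); case: (abs _ p); rewrite /= ?expr1 ?expr0; field.
lra.
Qed.

Lemma greedy_connect q1 q2 p P : (0 < q1)%N -> (0 < q2)%N ->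
  walk l H q1 p -> walk l H q2 P ->
  (conn * (conn + size (p ++ P)))%:R / #|V|%:R < c4 ->
  exists s, [/\ size s = conn, uniq s, ~~ has (mem (p ++ P)) s &
    walk l H 4 (last_end l p ++ s ++ take l P)].
Proof.
case: q1 => // q1 _; case: q2 => // q2 _ w1 w2 small.
have [_ _ pE szp] := walk_ends w1; have [PE szP _ _] := walk_ends w2.
have uE : uniq (last_end l p) by move: w1; rewrite {1}pE => /(walk_uniq_last l2_lt_k szp).
have uF : uniq (take l P) by move: w2; rewrite {1}PE => /(walk_uniq_first l2_lt_k szP).
have := avg_avoid_ge (p ++ P) (cc4 uE uF szp szP).
move/(avg_exists V_gt0) => [s szs]; have [/and3P[us dis ws] _|_] :=
  boolP [&& uniq s, ~~ has (mem (p ++ P)) s & walk l H 4 (last_end l p ++ s ++ take l P)].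
  by exists s.
by rewrite leNgt subr_gt0 small.
Qed.

(** The path starts as a single edge, and each round puts a new absorber and its connection,
    [b + conn] vertices in all, in front of it. *)
Lemma greedy N : (0 < q)%N -> (k - l <= #|V|)%N ->
  (exists2 e, size e = k & spans_edge H e) ->
  ((b + conn) * (b + conn + (k + N * (b + conn))))%:R / #|V|%:R <= c / 2 ->
  ((b + conn) * (b + conn + (k + N * (b + conn))))%:R / #|V|%:R < c4 ->
  exists ps P q', [/\ size ps = N, [/\ (0 < q')%N, walk l H q' P & uniq P],
    size P = (k + N * (b + conn))%N, absorbs_all ps P &
    potential ps <= (1 - c / 4) ^+ N * potential [::]].
Proof.
move=> q0 kn [e sze he]; elim: N => [|N IH] small small4.
  exists [::], e, 1%N; split=> //; first split=> //.
  - by rewrite walk1 // sze eqxx.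
  - exact: spans_edge_uniq he.
  - by rewrite mul0n addn0.
  - move=> [|//] _; exists 1%N, e; rewrite cats0; split=> //.
    by rewrite walk1 // sze eqxx.
  - by rewrite expr0 mul1r.
have nV0 : 0 < #|V|%:R^-1 :> R by rewrite invr_gt0 ltr0n.
have mono x y : (x <= y)%N -> x%:R / #|V|%:R <= y%:R / #|V|%:R :> R.
  by move=> xy; rewrite ler_pM2r // ler_nat.
have [||ps [P [q' [szps [q'0 wP uP] szP ab pot]]]] := IH.
- by apply: le_trans small; apply: mono; rewrite leq_mul // leq_add2l leq_add2l leq_mul2r leqnSn orbT.
- by apply: le_lt_trans small4; apply: mono; rewrite leq_mul // leq_add2l leq_add2l leq_mul2r leqnSn orbT.
have [|p [szp up dis wp potp]] := greedy_step ps (P := P) kn.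
  apply: le_trans small; apply: mono; rewrite szP mulSn.
  by apply: leq_mul; [rewrite leq_addr | clear; lia].
have [|s [szs us diss ws]] := greedy_connect q0 q'0 wp wP.
  apply: le_lt_trans small4; apply: mono; rewrite size_cat szp szP mulSn.
  by apply: leq_mul; [rewrite leq_addl | clear; lia].
exists (p :: ps), (p ++ s ++ P), (q + (4 + q'))%N; split.
- by rewrite /= szps.
- split; first by rewrite addn_gt0 q0.
    exact: walk_glue.
  rewrite !cat_uniq up us uP has_cat !andbT /=.
  rewrite -all_predC in diss; rewrite -all_predC in dis.
  apply/andP; split.
  + rewrite negb_or; apply/andP; split; apply/hasPn => x xs; apply/negP => /= xp.
      by have := allP diss _ xs; rewrite /= mem_cat xp.
    by have := allP dis _ xp; rewrite /= xs.
  + by apply/hasPn => x xP; apply/negP => /= xs; have := allP diss _ xs; rewrite /= mem_cat xP orbT.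
- by rewrite !size_cat szp szs szP mulSn; clear; lia.
- exact: absorbs_all_cons wp wP ws ab.
rewrite exprS -mulrA; apply: (le_trans potp); apply: ler_wpM2l pot.
have := c_le1; lra.
Qed.

End Greedy.

(** * The absorbing path *)

(** With j the quotient of [M] by m+1, 2^M >= (j+1)^(m+1) > (theta n/(m+1))^(m+1) = n^(m+1)/x, which
    exceeds n^m once n > x. *)
Lemma expn_lt_exp2 (R : realType) (theta : R) m : 0 < theta ->
  exists n0 : nat, forall n M : nat, (n0 <= n)%N -> theta * n%:R <= M%:R ->
    (n ^ m < 2 ^ M)%N.
Proof.
move=> t0; pose x : R := (m.+1%:R / theta) ^+ m.+1.
have x0 : 0 <= x by rewrite exprn_ge0 // divr_ge0 // ltW.
exists (Num.bound x) => n M nx le_M.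
have lt_x : x < n%:R.
  by apply: lt_le_trans (archi_boundP x0) _; rewrite ler_nat.
have n0 : 0 < n%:R :> R by apply: le_lt_trans lt_x.
pose j := (M %/ m.+1)%N.
have lt_j : theta * n%:R / m.+1%:R < j.+1%:R.
  rewrite ltr_pdivrMr ?ltr0n //; apply: (le_lt_trans le_M).
  by rewrite -natrM ltr_nat ltn_ceil.
have le_2 : (j.+1 ^ m.+1 <= 2 ^ M)%N.
  apply: (@leq_trans ((2 ^ j) ^ m.+1)); first by rewrite leq_exp2r // ltn_expl.
  by rewrite -expnM leq_exp2l // leq_trunc_div.
apply: leq_trans le_2; rewrite -(ltr_nat R) !natrX.
apply: (@lt_trans _ _ ((theta * n%:R / m.+1%:R) ^+ m.+1)); last first.
  by rewrite ltrXn2r ?nnegrE // divr_ge0 // mulr_ge0 // ltW.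
have -> : theta * n%:R / m.+1%:R = n%:R / (m.+1%:R / theta).
  by rewrite invf_div mulrA [n%:R * _]mulrC.
rewrite expr_div_n -/x ltr_pdivlMr; last first.
  by rewrite exprn_gt0 // divr_gt0 // ltr0n.
by rewrite mulrC exprS ltr_pM2r // exprn_gt0.
Qed.

Lemma bernoulli_quarter (R : realType) (x : R) : 0 < x <= 1 ->
  exists J : nat, (0 < J)%N /\ (1 - x) ^+ J <= 1 / 4.
Proof.
case/andP => x0 x1; exists (Num.bound (3 / x)).+1; split=> //; set J := _.+1.
have bern n : (1 - x) ^+ n * (1 + n%:R * x) <= 1.
  elim: n => [|n IH]; first by rewrite expr0 mul0r addr0 mulr1.
  apply: le_trans IH; rewrite exprSr -mulrA ler_wpM2l ?exprn_ge0 ?subr_ge0 //.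
  have n0 : 0 <= n%:R :> R by [].
  rewrite -natr1; nra.
have J3 : 3 <= J%:R * x.
  rewrite -ler_pdivrMr //; apply/ltW/(lt_le_trans (archi_boundP _)).
    by rewrite divr_ge0 // ltW.
  by rewrite ler_nat.
rewrite ler_pdivlMr //; apply: le_trans (bern J).
by rewrite ler_wpM2l ?exprn_ge0 ?subr_ge0 //; lra.
Qed.

Lemma bin_le_expn n m : ('C(n, m) <= n ^ m)%N.
Proof.
apply: (@leq_trans (n ^_ m)).
  by rewrite -bin_ffact leq_pmulr // fact_gt0.
rewrite ffact_prod -[X in (_ <= _ ^ X)%N]card_ord -prod_nat_const.
by apply: leq_prod => i _; rewrite leq_subr.
Qed.

Section Conclusion.

Variables (k l : nat) (V : finType) (H : kgraph k V).
Hypothesis l2_lt_k : (2 * l < k)%N.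

(** [X] is cut into blocks of size [k - l], at most [M] in number; as each has at least [M]
    absorbers, the blocks can be assigned to different absorbers. *)
Lemma absorbs_intro q ps (P : seq V) (M : nat) (X : {set V}) :
  absorbs_all l H q ps P -> uniq P ->
  (forall Y : {set V}, #|Y| = (k - l)%N ->
    (M <= count (fun p => `[< absorber l H q (enum Y) p >]) ps)%N) ->
  X \subset ~: [set x in P] -> (#|X| <= (k - l) * M)%N -> (k - l %| #|X|)%N ->
  absorbs l H P X.
Proof.
move=> ab uP many XP leX dvd; have m0 : (0 < k - l)%N by lia.
pose r := (#|X| %/ (k - l))%N.
have rE : (r * (k - l) = #|X|)%N by rewrite divnK.
pose bs := reshape (nseq r (k - l)%N) (enum X).
have sumr : sumn (nseq r (k - l)%N) = size (enum X) by rewrite sumn_nseq -cardE mulnC.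
have flE : flatten bs = enum X by rewrite reshapeKr // sumr.
have shE : shape bs = nseq r (k - l)%N by rewrite reshapeKl // sumr.
have szbs : size bs = r by rewrite size_reshape size_nseq.
have [os [okos os_bs _]] : exists os, [/\
    all2 (fun o p => (o == [::]) || `[< absorber l H q o p >]) os ps,
    perm_eq (flatten os) (flatten bs) & (count (predC1 [::]) os <= size bs)%N].
  apply: (assign_blocks (E := fun o p => `[< absorber l H q o p >])) => b bbs.
  have szb : size b = (k - l)%N.
    have : size b \in shape bs by apply: map_f.
    by rewrite shE mem_nseq => /andP[_ /eqP].
  have ub : uniq b.
    have := enum_uniq (mem X); rewrite -flE => ufl.
    have := subseq_uniq (_ : subseq b (flatten bs)) ufl; apply.
    move: bbs; clear; elim: bs => [//|a s IH]; rewrite inE /= => /orP[/eqP->|/IH sub].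
      exact: prefix_subseq.
    by apply: subseq_trans sub _; apply: suffix_subseq.
  have bE : perm_eq b (enum [set x in b]).
    by apply: uniq_perm; rewrite ?enum_uniq // => x; rewrite mem_enum inE.
  have cb : #|[set x in b]| = (k - l)%N by rewrite cardE -(perm_size bE).
  rewrite (eq_count (a2 := fun p => `[< absorber l H q (enum [set x in b]) p >])); last first.
    by move=> p; apply: absorber_perm.
  apply: leq_trans (many _ cb); rewrite szbs.
  by rewrite -(leq_pmul2r m0) rE mulnC.
have [q' [Q [q'0 wQ QE fQ eQ]]] := ab os okos.
have {}QE : perm_eq Q (P ++ enum X).
  by apply: perm_trans QE _; rewrite perm_cat2l -flE.
exists Q; split=> //.
  apply: (walk_lpath l2_lt_k q'0 _ wQ).
  rewrite (perm_uniq QE) cat_uniq uP enum_uniq andbT /=.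
  apply/hasPn => x; rewrite mem_enum => /(subsetP XP); by rewrite !inE.
by apply/setP => x; rewrite !inE (perm_mem QE) mem_cat mem_enum.
Qed.

End Conclusion.

(** From here on the two degree conditions are treated alike: either yields positive degrees of
    single vertices, pairs and [l]-tuples, and connections with four edges. *)
Lemma degree_setup (R : realType) (k l : nat) (eta : R) :
  (1 <= l)%N -> (2 * l < k)%N -> 0 < eta ->
  exists2 c : R, 0 < c & exists n0 : nat,
  forall (V : finType) (H : kgraph k V), (0 < #|V|)%N -> (n0 <= #|V|)%N ->
    ((2 <= l)%N /\
       (Num.max (1 / 3) ((1 / 2) `^ ((k - l)%N%:R / l%:R)) + eta)
         * 'C(#|V|, k - l)%:R <= (mindeg H l)%:R
     \/
     (1 / 3 + eta) * 'C(#|V|, k - l - 1)%:R <= (mindeg H (l + 1))%:R) ->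
  [/\ min_avg_degree H 1 c, min_avg_degree H 2 c, min_avg_degree H l c &
      connected_by l H 4 c].
Proof.
move=> l1 lk eta0.
set a : R := Num.max _ _.
have a0 : 0 <= a by rewrite le_max divr_ge0.
have eta20 : 0 < eta / 2 by rewrite divr_gt0.
have eta40 : 0 < eta / 4 by rewrite divr_gt0.
have [ci ci0 conn_i] := degree_connected l1 lk eta20.
have [cii cii0 [n1 conn_ii]] := codegree_connected l1 lk eta40.
have [n2 large_i] := div_le_large ((a + eta) * ((k - l) * (k - l))%:R) eta20.
have [n3 large_ii] := div_le_large ((1 / 3 + eta) * ((k - (l + 1)) * (k - (l + 1)))%:R) eta20.
have [n4 large_d] := div_le_large (l%:R * (1 / 3 + eta / 2)) eta40.
pose cd := eta / 2 / 2 ^+ l.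
have cd0 : 0 < cd by rewrite divr_gt0 // exprn_gt0.
pose c := Num.min cd (Num.min ci cii).
have c0 : 0 < c by rewrite !lt_min cd0 ci0.
have c_cd : c <= cd by rewrite ge_min lexx.
have c_ci : c <= ci by rewrite !ge_min lexx orbT.
have c_cii : c <= cii by rewrite !ge_min lexx !orbT.
exists c => //; exists (n1 + (n2 + (n3 + (n4 + 2 * k))))%N => V H V0 nV hyp.
have nV1 : (n1 <= #|V|)%N by move: nV; clear; lia.
have nV2 : (n2 <= #|V|)%N by move: nV; clear; lia.
have nV3 : (n3 <= #|V|)%N by move: nV; clear; lia.
have nV4 : (n4 <= #|V|)%N by move: nV; clear; lia.
have nVk : (2 * k <= #|V|)%N by move: nV; clear; lia.
have nR : 0 < #|V|%:R :> R by rewrite ltr0n.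
have down d x e : (e <= d <= l.+1)%N -> (1 <= e)%N -> eta / 2 <= x -> min_avg_degree H d x ->
    min_avg_degree H e c.
  move=> /andP[ed dl] e1 le_x mdd.
  have x0 : 0 <= x by apply: le_trans le_x; apply: ltW.
  apply: (min_avg_degree_le c_cd); apply: min_avg_degree_le (min_avg_degree_down V0 x0 _ nVk mdd).
    apply: ler_pM => //; first exact: ltW.
      by rewrite invr_ge0 exprn_ge0.
    rewrite lef_pV2 ?posrE ?exprn_gt0 // ler_weXn2l ?ler1n //.
    by move: ed dl e1; clear; lia.
  by rewrite ed /=; move: dl lk l1; clear; lia.
case: hyp => [[l2 le_d]|le_d].
  have a_eta0 : 0 <= a + eta by rewrite addr_ge0 // ltW.
  have lk' : (l <= k)%N by move: lk; clear; lia.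
  have mdl := mindeg_min_avg_degree V0 lk' a_eta0 le_d.
  have {}mdl : min_avg_degree H l (a + eta / 2).
    apply: min_avg_degree_le mdl; have := large_i _ nV2.
    by rewrite mulrBr mulr1 mulrA; lra.
  have ae : eta / 2 <= a + eta / 2 by rewrite lerDr.
  split.
  - by apply: down ae mdl; rewrite ?l1 ?leqnSn.
  (* Degrees of pairs come from those of [l]-tuples, by [2 <= l]; under the codegree condition they
     come from (l+1)-tuples. *)
  - by apply: down ae mdl; rewrite ?l2 ?leqnSn.
  - by apply: down ae mdl; rewrite ?leqnn ?leqnSn.
  have cc := conn_i V H V0 (min_avg_degree_le _ mdl).
  move=> L L' uL uL' szL szL'; apply: (le_trans c_ci); apply: cc => //.
  by rewrite lerD2r le_max lexx orbT.
have e0 : 0 <= 1 / 3 + eta by rewrite addr_ge0 ?divr_ge0 // ltW.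
have lk' : (l + 1 <= k)%N by move: lk l1; clear; lia.
rewrite -subnDA in le_d.
have md := mindeg_min_avg_degree V0 lk' e0 le_d.
have {}md : min_avg_degree H l.+1 (1 / 3 + eta / 2).
  rewrite addn1 in md; apply: min_avg_degree_le md; have := large_ii _ nV3.
  by rewrite addn1 mulrBr mulr1 mulrA; lra.
have e20 : 0 <= 1 / 3 + eta / 2 by rewrite addr_ge0 ?divr_ge0 // ltW.
have mdl : min_avg_degree H l (1 / 3 + eta / 4).
  apply: min_avg_degree_le (min_avg_degreeS V0 e20 _ md); last by move: lk l1; clear; lia.
  have := large_d _ nV4; rewrite mulrBl mul1r mulrAC; lra.
have ee : eta / 2 <= 1 / 3 + eta / 2 by rewrite lerDr divr_ge0.
split.
- by apply: down ee md; rewrite ?leqnn.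
- by apply: down ee md; rewrite ?leqnn ?ltnS ?l1.
- by apply: down ee md; rewrite ?leqnn ?leqnSn.
have cc := conn_ii V H nV1 mdl (min_avg_degree_le _ md).
move=> L L' uL uL' szL szL'; apply: (le_trans c_cii); apply: cc => //; lra.
Qed.

Theorem lemma3p5 (R : realType) (k l : nat) (eta : R) :
  (3 <= k)%N -> (1 <= l)%N -> (2 * l < k)%N -> 0 < eta ->
  exists gamma0 : R, 0 < gamma0 /\
  forall gamma : R, 0 < gamma -> gamma <= gamma0 ->
  exists theta0 : R, 0 < theta0 /\
  forall theta : R, 0 < theta -> theta <= theta0 ->
  exists n0 : nat, forall n : nat, (n0 <= n)%N ->
  forall (V : finType) (H : kgraph k V), #|V| = n ->
    ((2 <= l)%N /\
       (Num.max (1 / 3) ((1 / 2) `^ ((k - l)%N%:R / l%:R)) + eta)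
         * 'C(n, k - l)%:R <= (mindeg H l)%:R
     \/
     (1 / 3 + eta) * 'C(n, k - l - 1)%:R <= (mindeg H (l + 1))%:R) ->
  exists P : seq V,
    [/\ lpath_in l H P,
        #|[set x in P]|%:R <= gamma * n%:R &
        forall X : {set V},
          X \subset ~: [set x in P] -> #|X|%:R <= theta * n%:R ->
          (k - l %| #|X|)%N -> absorbs l H P X].
Proof.
move=> k3 l1 lk eta0.
have m0 : (0 < k - l)%N by move: lk; clear; lia.
have [d d0 [n1 setup]] := degree_setup l1 lk eta0.
have [q [b [q0 [c' c'0 [n2 abundant]]]]] := absorbers_abundant l1 lk d0 d0 d0 d0.
pose c := Num.min c' 1.
have c0 : 0 < c by rewrite lt_min c'0 /=.
have c1 : c <= 1 by rewrite ge_min lexx orbT.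
have c_c' : c <= c' by rewrite ge_min lexx.
pose mu := Num.min c d.
have mu0 : 0 < mu by rewrite lt_min c0.
have mu_c : mu <= c by rewrite ge_min lexx.
have mu_d : mu <= d by rewrite ge_min lexx orbT.
pose D := (b + (4 * (k - l) - l))%N.
have D0 : (0 < D)%N by rewrite /D; move: lk; clear; lia.
have DR : 0 < D%:R :> R by rewrite ltr0n.
have [J [J0 pJ]] : exists J : nat, (0 < J)%N /\ (1 - c / 4) ^+ J <= 1 / 4.
  by apply: bernoulli_quarter; apply/andP; split; lra.
have JR : 0 < J%:R :> R by rewrite ltr0n.
(* Each absorber adds [D] vertices to the path. This bound on gamma keeps the path short enough for
   collisions with it to cost at most [3 / 8 * mu] in each greedy step. *)
exists (mu / (4 * D%:R)); split; first by rewrite divr_gt0 // mulr_gt0.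
move=> gamma gamma0 le_gamma.
pose t0 := gamma / (4 * J%:R * D%:R).
have t00 : 0 < t0 by rewrite divr_gt0 // !mulr_gt0.
exists t0; split=> // theta theta0 le_theta.
have mu40 : 0 < mu / 4 by rewrite divr_gt0.
have gamma20 : 0 < gamma / 2 by rewrite divr_gt0.
have [n3 large_D] := div_le_large (D * (D + k))%:R mu40.
have [n4 large_k] := div_le_large k%:R gamma20.
have [n5 large_t] := div_le_large 1 t00.
have [n6 large_exp] := expn_lt_exp2 (k - l) t00.
exists (n1 + (n2 + (n3 + (n4 + (n5 + (n6 + k))))))%N => n nn V H nE hyp.
have le1 : (n1 <= n)%N by move: nn; clear; lia.
have le2 : (n2 <= n)%N by move: nn; clear; lia.
have le3 : (n3 <= n)%N by move: nn; clear; lia.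
have le4 : (n4 <= n)%N by move: nn; clear; lia.
have le5 : (n5 <= n)%N by move: nn; clear; lia.
have le6 : (n6 <= n)%N by move: nn; clear; lia.
have lek : (k <= n)%N by move: nn; clear; lia.
have n0 : (0 < n)%N by apply: leq_trans lek; apply: leq_trans k3.
have nR : 0 < n%:R :> R by rewrite ltr0n.
move: hyp le1 le2 n0; rewrite -{1 2 3 4 5}nE => hyp le1 le2 V0.
have [md1 md2 mdl cc4] := setup V H V0 le1 hyp.
have many X : size X = (k - l)%N -> c <= avg b (fun p => `[< absorber l H q X p >]%:R).
  by move=> szX; apply: le_trans c_c' _; apply: abundant.
(* [J * M] absorbers will be chosen, which fill at most half of the permitted length. The quotient
   is 2 [t0] n, and rounding down still leaves at least [t0] n as soon as [t0] n >= 1. *)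
pose M := Num.truncn (gamma * n%:R / (2 * J%:R * D%:R)).
have M_le : M%:R * (2 * J%:R * D%:R) <= gamma * n%:R.
  by rewrite -ler_pdivlMr ?mulr_gt0 // truncn_le divr_ge0 ?mulr_ge0 ?ltW.
have M_ge : t0 * n%:R <= M%:R.
  have : gamma * n%:R / (2 * J%:R * D%:R) < M.+1%:R := truncnS_gt _.
  have -> : gamma * n%:R / (2 * J%:R * D%:R) = 2 * (t0 * n%:R).
    by rewrite /t0; field; rewrite !gt_eqF.
  have : 1 <= t0 * n%:R by rewrite -ler_pdivrMr // large_t.
  by rewrite -[M.+1]addn1 natrD; lra.
pose N := (J * M)%N.
have ND : (N * D)%:R <= gamma * n%:R / 2.
  by rewrite ler_pdivlMr // /N !natrM; apply: le_trans M_le; rewrite le_eqVlt; apply/orP; left; apply/eqP; ring.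
have small : (D * (D + (k + N * D)))%:R / n%:R <= 3 / 8 * mu.
  rewrite ler_pdivrMr //.
  have h1 : (D * (D + k))%:R <= mu / 4 * n%:R by rewrite -ler_pdivrMr // large_D.
  have h2 : D%:R * (gamma * n%:R / 2) <= mu / 8 * n%:R.
    have : gamma * (4 * D%:R) <= mu by rewrite -ler_pdivlMr // mulr_gt0.
    move/(ler_wpM2r (ltW nR)); lra.
  rewrite addnA mulnDr natrD [(D * (N * D))%:R]natrM.
  have := ler_wpM2l (ltW DR) ND; lra.
have edge : exists2 e, size e = k & spans_edge H e.
  have /card_gt0P[v _] := V0.
  have [s szs] := avg_exists V0 (md1 [:: v] isT erefl).
  case e: (spans_edge H _); last by rewrite leNgt d0.
  by move=> _; exists (v :: s) => //=; rewrite szs subnSK ?subn0 //; apply: leq_trans k3.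
have kV : (k - l <= #|V|)%N by rewrite nE; apply: leq_trans lek; rewrite leq_subr.
have [||ps [P [q' [szps [q'0 wP uP] szP ab pot]]]] :=
  greedy V0 lk c0 c1 cc4 many (N := N) q0 kV edge.
- by rewrite nE -/D; lra.
- by rewrite nE -/D; lra.
have cardP : #|[set x in P]| = size P.
  by rewrite (eq_card (B := mem P)) ?(card_uniqP uP) // => x; rewrite inE.
exists P; split.
- exact: walk_lpath wP.
- rewrite cardP szP -/D natrD.
  have : k%:R <= gamma / 2 * n%:R by rewrite -ler_pdivrMr // large_k.
  lra.
move=> X XP leX dvd; apply: (absorbs_intro lk (M := M) ab uP) => //; last first.
  apply: (@leq_trans M); last by rewrite leq_pmull.
  rewrite -(ler_nat R); apply: (le_trans leX); apply: le_trans M_ge.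
  by rewrite ler_pM2r.
(* A set with fewer than [M] absorbers would alone contribute at least 2^(-M) to the potential.
   After [J * M] steps the potential is at most 4^(-M) n^(k-l), so 2^M <= n^(k-l), which is false
   for large n because [M] is linear in n. *)
move=> Y szY; rewrite leqNgt; apply/negP => lt_M.
have := large_exp n M le6 M_ge; rewrite ltnNge => /negP; apply.
rewrite -(ler_nat R) !natrX.
have le_pot : (1 / 2) ^+ M <= (1 / 4) ^+ M * n%:R ^+ (k - l) :> R.
  apply: (@le_trans _ _ (potential R l H q ps)).
    rewrite /potential (bigD1 Y) /= ?szY //; apply: ler_wpDr.
      by apply: sumr_ge0 => Z _; rewrite exprn_ge0 // divr_ge0.
    by rewrite ler_wiXn2l ?divr_ge0 //; [lra | apply: ltnW].
  apply: (le_trans pot); rewrite /N exprM; apply: ler_pM.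
  - by rewrite !exprn_ge0 //; lra.
  - exact: potential_ge0.
  - by rewrite lerXn2r ?nnegrE ?exprn_ge0 ?divr_ge0 //; lra.
  rewrite /potential sumr_const -natrX ler_nat.
  apply: leq_trans (bin_le_expn _ _); rewrite -nE -card_draws.
  by apply: subset_leq_card; apply/subsetP => Z; rewrite inE.
have e4 : (1 / 4) ^+ M = (1 / 2) ^+ M * (1 / 2) ^+ M :> R.
  by rewrite -exprMn; congr (_ ^+ _); field.
move: le_pot; rewrite e4 -mulrA ler_pMr ?exprn_gt0 ?divr_gt0 // => le_1.
by rewrite -[leLHS]mulr1 -ler_pdivlMl ?exprn_gt0 // -exprVn -[2^-1]div1r.
Qed.
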